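(* Let $d\ge 1$, let $u:(a,b)\times\mathbb{R}^{d}\rightarrow\mathbb{C}$ be biharmonic and suppose that there exist $t_{1}\in(a,b)$ and $c>0$ such that $a<t_{1}-c<t_{1}+c<b$ and $$u(t_{1},y)=0\quad\text{and}\quad u(t_{1}+c,y)=-u(t_{1}-c,y)$$ for all $y\in\mathbb{R}^{d}$. If $$\sup_{t\in[t_{1}-c,t_{1}+c]}|u(t,y)|\leq o\left(|y|^{(1-d)/2}e^{\frac{\pi}{c}|y|}\right)\quad\text{for }|y|\rightarrow\infty,$$ then $u$ is odd at $t=t_{1}$, i.e. $u(t_{1}+t,y)=-u(t_{1}-t,y)$ for all $t\in[-c,c]$ and all $y\in\mathbb{R}^{d}$.
   Context: A function $f:G\to\mathbb{C}$ on a domain $G$ in a Euclidean space is polyharmonic of order $N$ if it is $2N$ times continuously differentiable and $\Delta^{N}f=0$ on $G$, where $\Delta$ is the Laplace operator in all variables; biharmonic means polyharmonic of order $2$. Here the variables on the strip $(a,b)\times\mathbb{R}^d$ are $(t,y)$, $t\in(a,b)$, $y\in\mathbb{R}^d$, and $\Delta=\partial_t^2+\Delta_y$. The notation $g(y)\le o(\varphi(|y|))$ for $|y|\to\infty$ (with $g\ge 0$, $\varphi>0$) means $g(y)/\varphi(|y|)\to 0$ as $|y|\to\infty$; $|y|$ is the Euclidean norm. *)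

(* Defs.v *)
From HB Require Import structures.
From mathcomp Require Import all_boot all_order all_algebra.
From mathcomp Require Import complex.
From mathcomp Require Import all_classical all_reals all_analysis.

Set Implicit Arguments.
Unset Strict Implicit.
Unset Printing Implicit Defensive.

Import Order.TTheory GRing.Theory Num.Theory.
Import numFieldNormedType.Exports.

Local Open Scope classical_set_scope.
Local Open Scope ring_scope.

(* [Rcomplex R] is R[i] seen as a real vector space, already normed in [complex]
   by the R-valued modulus. The instances below complete it to a
   [normedModType R], so that ['D_v f] applies to complex-valued functions of
   real variables. *)
Section Rcomplex_normedModType.
Variable R : realType.

Lemma Rcomplex_normrZ (l : R) (z : Rcomplex R) : `|l *: z| = `|l| * `|z|.
Proof.
case: z => x y.
rewrite /Num.norm /= !exprMn -mulrDr sqrtrM ?sqr_ge0 //.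
by rewrite sqrtr_sqr.
Qed.

HB.instance Definition _ := PseudoMetric.copy (Rcomplex R)
  (pseudoMetric_normed (Rcomplex R)).
HB.instance Definition _ := isPointed.Build (Rcomplex R) 0.
HB.instance Definition _ :=
  NormedZmod_PseudoMetric_eq.Build R (Rcomplex R) erefl.
HB.instance Definition _ :=
  PseudoMetricNormedZmod_Lmodule_isNormedModule.Build R (Rcomplex R)
    Rcomplex_normrZ.

End Rcomplex_normedModType.

Section Polyharmonic.
Variables (R : realType) (n : nat) (V : normedModType R).
Implicit Types (f : 'rV[R]_n -> V) (G : set 'rV[R]_n).

Definition partial (i : 'I_n) f : 'rV[R]_n -> V :=
  fun x => 'D_(delta_mx 0 i) f x.

Definition laplacian f : 'rV[R]_n -> V :=
  fun x => \sum_(i < n) partial i (partial i f) x.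

(* Intended for open G: then the values of f outside G are irrelevant. *)
Fixpoint Cn_on (k : nat) G f : Prop :=
  (forall x, G x -> {for x, continuous f}) /\
  (if k is k'.+1 then
     forall i : 'I_n,
       (forall x, G x -> derivable f x (delta_mx 0 i)) /\
       Cn_on k' G (partial i f)
   else True).

Definition polyharmonic (N : nat) G f : Prop :=
  Cn_on (2 * N) G f /\ (forall x, G x -> iter N laplacian f x = 0).

Definition biharmonic := polyharmonic 2.

End Polyharmonic.

Section Strip.
Variables (R : realType) (d : nat).

Definition pt (t : R) (y : 'rV[R]_d) : 'rV[R]_(1 + d) := row_mx t%:M y.

Definition strip (a b : R) : set 'rV[R]_(1 + d) :=
  [set pt t y | t in `]a, b[ & y in [set: 'rV[R]_d]].

(* The library norm on 'rV[R]_d is the sup norm. *)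
Definition enorm (y : 'rV[R]_d) : R := Num.sqrt (\sum_(i < d) y 0 i ^+ 2).

(* The filter "|y| -> oo" on R^d. *)
Definition enorm_infty : set_system 'rV[R]_d :=
  filter_from [set: R] (fun M => [set y | M < enorm y]).

End Strip.

Arguments strip {R} d a b.
Arguments enorm_infty {R d}.

(* Main.v *)
Require Import Defs.
From mathcomp Require Import all_boot all_order all_algebra.
From mathcomp Require Import complex.
From mathcomp Require Import all_classical all_reals all_analysis.
From mathcomp Require Import ring lra.
Set Implicit Arguments.
Unset Strict Implicit.
Unset Printing Implicit Defensive.
Import Order.TTheory GRing.Theory Num.Theory.
Import numFieldNormedType.Exports.
Local Open Scope classical_set_scope.
Local Open Scope ring_scope.

(** Write [t = z_0] for the first coordinate, with the origin moved to [t1], and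
    let [v] be the even part in [t] of the real or of the imaginary part of [u].
    It is biharmonic, vanishes at [t = 0] and at [t = c], and the claim is
    [v = 0]. There are three ideas.

    Factorisation. If [w] is the Laplacian of [v], then
    [H (t, y) = 1/2 \int_0^t w (s, y) ds] is harmonic, because [w] is harmonic and
    even in [t]; and the Laplacian of [t * H] is [2 * H_t = w]. Hence [v - t * H]
    is harmonic, even, and vanishes with its first [t]-derivative at [t = 0]; so
    it is zero, and [v = t * H] ([almansi]). Now [H] is a harmonic function that
    vanishes on both boundary hyperplanes of the strip [0 <= t <= c].

    Local bound. The growth hypothesis bounds [v], hence [H] only up to the factor
    [1/t]. A comparison on a box with Poisson kernels of half planes removes the
    singular factor, and a comparison with a quadratic barrier then gives
    [|H| <= C * M * min (t, c - t)] when [|v| <= M] nearby ([quotient_edge_bound]).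
    So [H] is at infinity an arbitrarily small multiple of
    [sin (pi t / c) * |y|^((1-d)/2) * exp (pi |y| / c)].

    Liouville. With [k = pi/c], [rho = sqrt (a^2 + |y|^2)] and [a] large enough,
    [sin (k t) * rho^((1-d)/2) * exp (k rho)] is superharmonic in the strip
    ([lap_radial_barrier]), so every small multiple of it dominates [|H|] on all
    large boxes, and [H = 0] ([strip_liouville]).

    Every estimate comes from the maximum principle on boxes, [comparison]. This
    includes unique continuation from zero Cauchy data ([unique_continuation]),
    which rests on finite differences: comparison with a quadratic barrier bounds
    [f (x + s e) - f (x - s e)] by [2 s (n/r) sup |f|] for harmonic [f] in dimension
    [n] on a cube of half width [r] ([harmonic_difference_le]), and the backward differences of [f] are again
    harmonic, so iterating costs no derivative. With [m] steps of length [t/m] the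
    difference of order [m] is at most [(C t)^m sup |f|]; summing back from zero
    values multiplies by at most [4^m], so [f] vanishes for small [t]. *)


(** * Second derivatives in one variable *)
Section SecondDerivative.
Variable R : realType.
Implicit Types (f g : R -> R) (s l : R).

(** A second derivative that asks for a first derivative only near the point: this
    is what the second derivative test uses, and it can be checked directly for a
    function glued from two pieces along a hyperplane. *)
Definition sder f s l := exists g : R -> R,
  (\forall t \near s, is_derive (t : R) 1 f (g t)) /\ is_derive s 1 g l.

Lemma sder_everywhere f g s l :
  (forall t : R, is_derive t 1 f (g t)) -> is_derive s 1 g l -> sder f s l.
Proof. by move=> fg gl; exists g; split; [apply: filterE => t; exact: fg | exact: gl]. Qed.

Lemma sderD f1 f2 s l1 l2 : sder f1 s l1 -> sder f2 s l2 ->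
  sder (fun t => f1 t + f2 t) s (l1 + l2).
Proof.
move=> [g1 [d1 e1]] [g2 [d2 e2]]; exists (fun t => g1 t + g2 t); split.
  near=> t.
  have h1 : is_derive t 1 f1 (g1 t) by near: t.
  have h2 : is_derive t 1 f2 (g2 t) by near: t.
  exact: is_deriveD.
exact: is_deriveD.
Unshelve. all: by end_near. Qed.

Lemma sderZ f s l (k : R) : sder f s l -> sder (fun t => k * f t) s (k * l).
Proof.
move=> [g [d e]]; exists (fun t => k * g t); split.
  near=> t.
  have h1 : is_derive t 1 f (g t) by near: t.
  exact: is_deriveZ.
exact: is_deriveZ.
Unshelve. all: by end_near. Qed.

Lemma sder_cst (a s : R) : sder (fun=> a) s 0.
Proof. by apply: (@sder_everywhere _ (fun=> 0)) => *; exact: is_derive_cst. Qed.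

Lemma sder_near f1 f2 s l : (\forall t \near s, f1 t = f2 t) ->
  sder f1 s l -> sder f2 s l.
Proof.
move=> /near_join E [g [d e]]; exists g; split => //.
near=> t.
have h1 : is_derive t 1 f1 (g t) by near: t.
apply: near_eq_is_derive h1; last by near: t.
Unshelve. all: by end_near. Qed.

Lemma sder_eq f s l l' : sder f s l -> l = l' -> sder f s l'.
Proof. by move=> ? <-. Qed.

Lemma is_derive_affine (a b s : R) : is_derive s 1 (fun t => a + b * t) b.
Proof.
apply: (is_derive_eq (is_deriveD (is_derive_cst a s 1) (is_deriveZ b (is_derive_id s 1)))).
by rewrite add0r /GRing.scale /= mulr1.
Qed.

Lemma is_derive_chain f g s a b l : is_derive (g s) 1 f a -> is_derive s 1 g b ->
  l = b * a -> is_derive s 1 (fun t => f (g t)) l.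
Proof. by move=> fa gb ->; rewrite mulrC; exact: (@is_derive1_comp _ f g). Qed.

Lemma sder_comp_affine f (a b s l : R) : sder f (a + b * s) l ->
  sder (fun t => f (a + b * t)) s (b ^+ 2 * l).
Proof.
move=> [g [d e]]; exists (fun t => b * g (a + b * t)); split.
  have c : (fun t : R => a + b * t) @ s --> a + b * s.
    by apply: cvgD; [exact: cvg_cst|apply: cvgM; [exact: cvg_cst|exact: cvg_id]].
  apply: (@filterS _ (nbhs s) _ _ _ _ (c _ d)) => t /= h.
  exact: (@is_derive_chain f (fun t => a + b * t) _ _ _ _ h (is_derive_affine a b t)).
have h3 := @is_derive_chain g (fun t => a + b * t) _ _ _ _ e (is_derive_affine a b s) erefl.
apply: (is_derive_eq (is_deriveZ b h3)).
by rewrite /GRing.scale /= expr2 mulrA.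
Qed.

(** Where the first derivative vanishes and the second is negative, the function
    is strictly decreasing just to the right, so it has no minimum there. *)
Lemma sder_ge0_at_min f s l : sder f s l ->
  (\forall t \near s, f s <= f t) -> 0 <= l.
Proof.
move=> [g [d e]] m.
have [e1 /= e1p He1] : exists2 e1 : R, 0 < e1 &
    forall t, `|s - t| < e1 -> is_derive t 1 f (g t) /\ f s <= f t.
  have [e1 /= ep H] := (nbhs_ballP _ _).1 (filterI d m).
  by exists e1 => // t ht; apply: H.
have gs0 : g s = 0.
  have h0 : is_derive s 1 f 0.
    apply: (@derive1_at_min _ f (s - e1) (s + e1) s); first by lra.
    - move=> t; rewrite in_itv /= => /andP[h1 h2].
      have [] := He1 t; first by rewrite ltr_norml; apply/andP; split; lra.
      by move=> ? _; apply: ex_derive.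
    - by rewrite in_itv /=; lra.
    - move=> t; rewrite in_itv /= => /andP[h1 h2].
      by have [] := He1 t; first by rewrite ltr_norml; apply/andP; split; lra.
  have [h1 _] : is_derive s 1 f (g s) /\ f s <= f s.
    by apply: He1; rewrite subrr normr0.
  by rewrite -(@derive_val _ _ _ _ _ _ _ h0) (@derive_val _ _ _ _ _ _ _ h1).
rewrite leNgt; apply/negP => l0.
have cv : (h^-1 * (g (h + s) - g s)) @[h --> 0^'] --> l.
  have /cvg_ex[l' /= hl'] := @ex_derive _ _ _ _ _ _ _ e.
  have -> : l = l'.
    by rewrite -(@derive_val _ _ _ _ _ _ _ e) /derive; apply: cvg_lim hl'.
  by move: hl'; under eq_fun do rewrite /= /GRing.scale /= mulr1.
have /cv : nbhs l [set z : R | z < 0] by exact: lt_nbhsl.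
rewrite /nbhs /= => -[e2 /= e2p He2].
pose h := Num.min e1 e2 / 2.
have m12 : 0 < Num.min e1 e2 by rewrite lt_min e1p.
have hp : 0 < h by rewrite /h; lra.
have [he1 he2] : h < e1 /\ h < e2.
  have : h < Num.min e1 e2 by rewrite /h; lra.
  by rewrite lt_min => /andP.
have gneg t : 0 < t -> t <= h -> g (t + s) < 0.
  move=> t0 th.
  have := He2 t; rewrite /= sub0r normrN gtr0_norm// gs0 subr0.
  move=> /(_ (le_lt_trans th he2)); rewrite gt_eqF// => /(_ isT).
  by rewrite /GRing.scale /= pmulr_rlt0// invr_gt0.
have [|||c] := @MVT _ f g s (s + h).
- by lra.
- move=> x; rewrite in_itv /= => /andP[h1 h2].
  by have [] := He1 x; first by rewrite ltr_norml; apply/andP; split; lra.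
- apply: derivable_within_continuous => x; rewrite in_itv /= => /andP[h1 h2].
  have [|h3 _] := He1 x; first by rewrite ltr_norml; apply/andP; split; lra.
  exact: (@ex_derive _ _ _ _ _ _ _ h3).
rewrite in_itv /= => /andP[c1 c2] E.
have [|_] := He1 (s + h); first by rewrite ltr_norml; apply/andP; split; lra.
have := gneg (c - s); rewrite subrK => /(_ ltac:(lra) ltac:(lra)).
move: E; have -> : s + h - s = h by ring.
by nra.
Unshelve. all: by end_near. Qed.


End SecondDerivative.

Section OneVariable.
Variable R : realType.
Implicit Types (f g : R -> R) (s l : R).

Lemma is_derive_uniq f s l l' : is_derive s 1 f l -> is_derive s 1 f l' -> l = l'.
Proof.
by move=> h h'; rewrite -(@derive_val _ _ _ _ _ _ _ h) (@derive_val _ _ _ _ _ _ _ h').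
Qed.

Lemma sder_uniq f s l l' : sder f s l -> sder f s l' -> l = l'.
Proof.
move=> [g [fg gl]] [g' [fg' gl']].
have E : \forall t \near s, g t = g' t.
  near=> t; apply: (@is_derive_uniq f t); near: t; [exact: fg|exact: fg'].
exact: is_derive_uniq (near_eq_is_derive E gl) gl'.
Unshelve. all: by end_near. Qed.

Lemma is_derive_even f l : (forall s, f (- s) = f s) -> is_derive (0 : R) 1 f l -> l = 0.
Proof.
move=> fe fl.
have h : is_derive (0 + -1 * 0 : R) 1 f l by rewrite mulr0 addr0.
have := @is_derive_chain R f (fun s => 0 + -1 * s) 0 _ _ _ h (is_derive_affine 0 (-1) 0) erefl.
rewrite (_ : (fun t => _) = f); last first.
  by apply/funext => t; rewrite add0r mulN1r fe.
move=> /(is_derive_uniq fl); rewrite mulN1r; lra.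
Qed.

Lemma is_derive_const_itv f (a b : R) :
  (forall t, a < t < b -> is_derive (t : R) 1 f 0) ->
  forall s t, a < s < b -> a < t < b -> f s = f t.
Proof.
move=> df; suff H (s t : R) : a < s < b -> a < t < b -> s < t -> f s = f t.
  by move=> s t hs ht; case: (ltgtP s t) => [|ts|->//]; [exact: H|rewrite (H t s)].
move=> /andP[s1 s2] /andP[t1 t2] st.
have dd w : s <= w -> w <= t -> is_derive w 1 f 0.
  by move=> w1 w2; apply: df; apply/andP; split; lra.
have [||w _] := @MVT R f (fun=> 0) s t st.
- by move=> w; rewrite in_itv /= => /andP[w1 w2]; apply: dd; exact: ltW.
- apply: derivable_within_continuous => w; rewrite in_itv /= => /andP[w1 w2].
  exact: (@ex_derive _ _ _ _ _ _ _ (dd w w1 w2)).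
by rewrite mul0r => /eqP; rewrite subr_eq0 => /eqP.
Qed.

Lemma is_deriveP f s l : is_derive s 1 f l <->
  (h^-1 * (f (h + s) - f s)) @[h --> 0^'] --> l.
Proof.
have E : (fun h : R => h^-1 *: ((f \o shift s) (h *: 1) - f s)) =
    fun h => h^-1 * (f (h + s) - f s).
  by apply/funext => h; rewrite /= /GRing.scale /= mulr1.
split=> [[/cvg_ex[l' hl'] <-]|h].
  rewrite /derive; rewrite (cvg_lim (@Rhausdorff R) hl').
  by rewrite -E.
rewrite -E in h; split; first by apply/cvg_ex; exists l.
exact: (cvg_lim (@Rhausdorff R) h).
Qed.

(** Cutting off a function at a zero of order two keeps it differentiable. *)
Lemma is_derive_cutoff f : f 0 = 0 -> is_derive (0 : R) 1 f 0 ->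
  is_derive (0 : R) 1 (fun s => if 0 < s then f s else 0) 0.
Proof.
move=> f0 /is_deriveP/cvgr0Pnorm_le h; apply/is_deriveP/cvgr0Pnorm_le => e e0.
have := h e e0; apply: filterS => t; rewrite ltxx addr0 f0 !subr0.
by case: ifP => // _ _; rewrite mulr0 normr0 ltW.
Qed.

Lemma sder_cutoff f : f 0 = 0 -> is_derive (0 : R) 1 f 0 -> sder f 0 0 ->
  sder (fun s => if 0 < s then f s else 0) 0 0.
Proof.
move=> f0 df [g [fg gl]].
have g0 : g 0 = 0 by apply: is_derive_uniq df; exact: nbhs_singleton fg.
exists (fun s => if 0 < s then g s else 0); split; last exact: is_derive_cutoff.
apply: filterS fg => t dt.
case: (ltgtP 0 t) => [t0|t0|<-].
- apply: near_eq_is_derive dt; have := lt_nbhsr t0.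
  by apply: filterS => s /= ->.
- apply: near_eq_is_derive (is_derive_cst 0 t 1); have := lt_nbhsl t0.
  by apply: filterS => s /= s0; rewrite ltNge ltW.
- exact: is_derive_cutoff.
Qed.

Lemma is_derive_bigsum (I : Type) (r : seq I) (P : pred I) (F : I -> R -> R)
    (L : I -> R) s : (forall i, P i -> is_derive s 1 (F i) (L i)) ->
  is_derive s 1 (fun t => \sum_(i <- r | P i) F i t) (\sum_(i <- r | P i) L i).
Proof.
move=> FL; elim: r => [|i r IH].
  rewrite big_nil; under [X in is_derive _ _ X]eq_fun do rewrite big_nil.
  exact: is_derive_cst.
rewrite big_cons; under [X in is_derive _ _ X]eq_fun do rewrite big_cons.
by case: ifP => [/FL|_] //; move=> h; exact: is_deriveD.
Qed.

Lemma is_derive_frac f g s (df dg : R) : g s != 0 ->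
  is_derive s 1 f df -> is_derive s 1 g dg ->
  is_derive s 1 (fun t => f t / g t) ((df * g s - f s * dg) / g s ^+ 2).
Proof.
move=> g0 hf hg.
apply: (is_derive_eq (is_deriveM hf (is_deriveV g0 hg))).
by rewrite /GRing.scale /=; field.
Qed.

Lemma is_derive_quadratic (p : R -> R) (a b c s : R) :
  (forall t, p t = a + b * t + c * t ^+ 2) -> is_derive s 1 p (b + 2 * c * s).
Proof.
move=> pE; have -> : p = fun t => (a + b * t) + c * (t * t).
  by apply/funext => t; rewrite pE expr2.
apply: (is_derive_eq (is_deriveD (is_derive_affine a b s)
  (is_deriveZ c (is_deriveM (is_derive_id s 1) (is_derive_id s 1))))).
by rewrite /GRing.scale /=; ring.
Qed.

Lemma sder_quadratic (p : R -> R) (a b c s : R) :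
  (forall t, p t = a + b * t + c * t ^+ 2) -> sder p s (2 * c).
Proof.
move=> pE; apply: (@sder_everywhere _ p (fun t => b + 2 * c * t)).
  by move=> t; exact: is_derive_quadratic pE.
exact: is_derive_affine.
Qed.

End OneVariable.

(** * The Laplacian along coordinate lines *)
Section Laplacian.
Variables (R : realType) (n : nat).
Implicit Types (f g : 'rV[R]_n -> R) (x : 'rV[R]_n).

Definition line x (i : 'I_n) (s : R) : 'rV[R]_n := x + s *: delta_mx 0 i.

Lemma lineE x i s j : line x i s 0 j = x 0 j + s * (i == j)%:R.
Proof. by rewrite !mxE eqxx /= eq_sym. Qed.

Lemma line_diag x i s : line x i s 0 i = x 0 i + s.
Proof. by rewrite lineE eqxx mulr1. Qed.

Lemma line_off x i s j : i != j -> line x i s 0 j = x 0 j.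
Proof. by rewrite lineE => /negPf->; rewrite mulr0 addr0. Qed.

Lemma line0 x i : line x i 0 = x.
Proof. by rewrite /line scale0r addr0. Qed.

Lemma line_line x i s t : line (line x i s) i t = line x i (s + t).
Proof. by rewrite /line scalerDl addrA. Qed.

Lemma is_derive_line f x i s (l : R) :
  is_derive (0 : R) 1 (fun r => f (line (line x i s) i r)) l ->
  is_derive s 1 (fun r => f (line x i r)) l.
Proof.
have {1}<- : - s + 1 * s = 0 by rewrite mul1r addNr.
move=> h.
have := @is_derive_chain R (fun r => f (line (line x i s) i r))
  (fun r => - s + 1 * r) s _ _ l h (is_derive_affine (- s) 1 s).
rewrite mul1r => /(_ erefl).
rewrite (_ : (fun t => _) = fun r => f (line x i r))//.
by apply/funext => r; rewrite line_line; congr (f (line _ _ _)); ring.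
Qed.

Lemma cvg_line x i s : line x i t @[t --> s] --> line x i s.
Proof.
apply: cvgD; first exact: cvg_cst.
by apply: cvgZr_tmp; exact: cvg_id.
Qed.

(** A relation rather than a function, so that it records the existence of the
    pure second derivatives. *)
Definition lap f x (L : R) := exists l : 'I_n -> R,
  (forall i, sder (fun s => f (line x i s)) 0 (l i)) /\ \sum_i l i = L.

Lemma lapD f g x L M : lap f x L -> lap g x M ->
  lap (fun z => f z + g z) x (L + M).
Proof.
move=> [l [fl <-]] [m [gm <-]]; exists (fun i => l i + m i).
by rewrite big_split; split => // i; exact: sderD.
Qed.

Lemma lapZ f x (k : R) L : lap f x L -> lap (fun z => k * f z) x (k * L).
Proof.
move=> [l [fl <-]]; exists (fun i => k * l i).
by rewrite mulr_sumr; split => // i; exact: sderZ.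
Qed.

Lemma lapN f x L : lap f x L -> lap (fun z => - f z) x (- L).
Proof.
move=> /(lapZ (-1)); rewrite mulN1r.
by under [X in lap X]eq_fun do rewrite mulN1r.
Qed.

Lemma lapB f g x L M : lap f x L -> lap g x M ->
  lap (fun z => f z - g z) x (L - M).
Proof. by move=> fl /lapN; exact: lapD. Qed.

Lemma lap_cst (a : R) x : lap (fun=> a) x 0.
Proof.
by exists (fun=> 0); rewrite big1//; split => // i; exact: sder_cst.
Qed.

Lemma lap_sum (I : Type) (r : seq I) (P : pred I) (F : I -> 'rV[R]_n -> R)
    (L : I -> R) x : (forall i, P i -> lap (F i) x (L i)) ->
  lap (fun z => \sum_(i <- r | P i) F i z) x (\sum_(i <- r | P i) L i).
Proof.
move=> FL; elim: r => [|i r IH].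
  rewrite big_nil; under [X in lap X]eq_fun do rewrite big_nil.
  exact: lap_cst.
rewrite big_cons; under [X in lap X]eq_fun do rewrite big_cons.
by case: ifP => [/FL|_] //; move=> h; exact: lapD.
Qed.

Lemma lap_eq f x L L' : lap f x L -> L = L' -> lap f x L'.
Proof. by move=> ? <-. Qed.

Lemma lap_near f g x L : (\forall z \near x, f z = g z) ->
  lap f x L -> lap g x L.
Proof.
move=> E [l [fl lL]]; exists l; split => // i.
apply: sder_near (fl i).
by have c := @cvg_line x i 0; rewrite line0 in c; exact: (c _ E).
Qed.

Lemma lap_coord (j : 'I_n) (q : R -> R) x (l : R) : sder q (x 0 j) l ->
  lap (fun z => q (z 0 j)) x l.
Proof.
move=> ql; exists (fun i => if i == j then l else 0); split; last first.
  by rewrite -big_mkcond big_pred1_eq.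
move=> i; have [->|ij] := eqVneq i j.
  rewrite (_ : (fun s => _) = fun s => q (x 0 j + 1 * s)); last first.
    by apply/funext => s; rewrite line_diag mul1r.
  apply: sder_eq.
    by apply: sder_comp_affine; rewrite mulr0 addr0; exact: ql.
  by rewrite expr1n mul1r.
under eq_fun do rewrite line_off//.
exact: sder_cst.
Qed.

Lemma lap_coord2 (j k : 'I_n) (q : R -> R -> R) x (l m : R) : j != k ->
  sder (fun s => q s (x 0 k)) (x 0 j) l -> sder (q (x 0 j)) (x 0 k) m ->
  lap (fun z => q (z 0 j) (z 0 k)) x (l + m).
Proof.
move=> jk ql qm.
exists (fun i => (if i == j then l else 0) + (if i == k then m else 0)).
split; last by rewrite big_split /= -!big_mkcond !big_pred1_eq.
move=> i; have [->|ij] := eqVneq i j.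
  rewrite (negPf jk) addr0.
  rewrite (_ : (fun s => _) = fun s => q (x 0 j + 1 * s) (x 0 k)); last first.
    by apply/funext => s; rewrite line_diag line_off// mul1r.
  apply: sder_eq.
    apply: (@sder_comp_affine _ (fun s => q s (x 0 k))).
    by rewrite mulr0 addr0; exact: ql.
  by rewrite expr1n mul1r.
have [->|ik] := eqVneq i k.
  rewrite add0r; rewrite eq_sym in jk.
  rewrite (_ : (fun s => _) = fun s => q (x 0 j) (x 0 k + 1 * s)); last first.
    by apply/funext => s; rewrite line_diag line_off// mul1r.
  apply: sder_eq.
    by apply: sder_comp_affine; rewrite mulr0 addr0; exact: qm.
  by rewrite expr1n mul1r.
under eq_fun do rewrite !line_off//.
by rewrite addr0; exact: sder_cst.
Qed.

Definition cont f x := {for x, continuous f}.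

Lemma cont_cst (a : R) x : cont (fun=> a) x.
Proof. exact: cst_continuous. Qed.

Lemma contD f g x : cont f x -> cont g x -> cont (fun z => f z + g z) x.
Proof. by move=> cf cg; exact: (cvgD cf cg). Qed.

Lemma contB f g x : cont f x -> cont g x -> cont (fun z => f z - g z) x.
Proof. by move=> cf cg; exact: (cvgB cf cg). Qed.

Lemma contM f g x : cont f x -> cont g x -> cont (fun z => f z * g z) x.
Proof. by move=> cf cg; exact: (cvgM cf cg). Qed.

Lemma contN f x : cont f x -> cont (fun z => - f z) x.
Proof. by move=> cf; exact: (cvgN cf). Qed.

Lemma cont_coord x j : cont (fun z => z 0 j) x.
Proof. exact: coord_continuous. Qed.

Lemma cont_comp (q : R -> R) f x : cont f x -> {for f x, continuous q} ->
  cont (fun z => q (f z)) x.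
Proof. by move=> cf cq; exact: (continuous_comp cf cq). Qed.

Lemma cont_sum (I : Type) (r : seq I) (P : pred I) (F : I -> 'rV[R]_n -> R) x :
  (forall i, P i -> cont (F i) x) ->
  cont (fun z => \sum_(i <- r | P i) F i z) x.
Proof.
move=> FL; elim: r => [|i r IH].
  under [X in cont X]eq_fun do rewrite big_nil.
  exact: cont_cst.
under [X in cont X]eq_fun do rewrite big_cons.
by case: ifP => [/FL|_] //; move=> h; exact: contD.
Qed.

Definition harm f x := cont f x /\ lap f x 0.

Lemma harmB f g x : harm f x -> harm g x -> harm (fun z => f z - g z) x.
Proof.
move=> [cf lf] [cg lg]; split; first exact: contB.
by rewrite -(subr0 0); exact: lapB.
Qed.

Lemma harmN f x : harm f x -> harm (fun z => - f z) x.
Proof.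
move=> [cf lf]; split; first exact: contN.
by rewrite -oppr0; exact: lapN.
Qed.

(** The affine substitution [a + b * x_i] in one coordinate; slope 1 gives a
    translation and slope -1 a reflection, the two cases that preserve the
    Laplacian. *)
Definition flip (i : 'I_n) (a b : R) x := line x i (a + (b - 1) * x 0 i).

Lemma flip_diag i a b x : flip i a b x 0 i = a + b * x 0 i.
Proof. by rewrite line_diag; ring. Qed.

Lemma flip_off i a b x j : i != j -> flip i a b x 0 j = x 0 j.
Proof. exact: line_off. Qed.

Lemma flip_line i a b x j s :
  flip i a b (line x j s) = line (flip i a b x) j (if j == i then b * s else s).
Proof.
apply/rowP => k; rewrite [RHS]lineE.
have [<-|ik] := eqVneq i k.
  rewrite !flip_diag lineE; have [_|_] := eqVneq j i.
    by rewrite !mulr1; ring.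
  by rewrite !mulr0 !addr0.
rewrite !flip_off// lineE; have [->|//] := eqVneq j i.
by rewrite (negPf ik) !mulr0.
Qed.

Lemma cvg_flip i a b x : flip i a b z @[z --> x] --> flip i a b x.
Proof.
have c : a + (b - 1) * (z : 'rV[R]_n) 0 i @[z --> x] --> a + (b - 1) * x 0 i.
  exact: (cvgD (cvg_cst a) (cvgM (cvg_cst (b - 1)) (@cont_coord x i))).
exact: (cvgD cvg_id (cvgZr_tmp c)).
Qed.

Lemma lap_flip i (a b : R) f x L : b ^+ 2 = 1 -> lap f (flip i a b x) L ->
  lap (fun z => f (flip i a b z)) x L.
Proof.
move=> b2 [l [fl lL]].
exists l; split => // j; under eq_fun do rewrite flip_line.
have [ji|ji] := boolP (j == i); last exact: fl.
apply: sder_eq.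
  under eq_fun do rewrite -[X in line _ _ X]add0r.
  apply: (@sder_comp_affine _ (fun s => f (line (flip i a b x) j s))).
  by rewrite mulr0 addr0; exact: fl.
by rewrite b2 mul1r.
Qed.

Lemma cont_flip i (a b : R) f x : cont f (flip i a b x) ->
  cont (fun z => f (flip i a b z)) x.
Proof. by move=> cf; apply: continuous_comp; [exact: cvg_flip|exact: cf]. Qed.

Lemma harm_flip i (a b : R) f x : b ^+ 2 = 1 -> harm f (flip i a b x) ->
  harm (fun z => f (flip i a b z)) x.
Proof. by move=> b2 [cf lf]; split; [exact: cont_flip|exact: lap_flip]. Qed.

Definition box (lo hi : 'rV[R]_n) : set 'rV[R]_n :=
  [set x | forall i, lo 0 i <= x 0 i <= hi 0 i].

Lemma compact_box lo hi : compact (box lo hi).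
Proof.
have := @rV_compact R n (fun i => `[lo 0 i, hi 0 i]%classic)
  (fun i => @segment_compact R _ _).
congr compact; apply/seteqP; split => x h i; have := h i; by rewrite /= in_itv.
Qed.

Lemma box_bounded f lo hi : (forall x, box lo hi x -> cont f x) ->
  exists M, forall x, box lo hi x -> `|f x| <= M.
Proof.
move=> cf; have [ne|em] := pselect (box lo hi !=set0); last first.
  by exists 0 => x bx; exfalso; apply: em; exists x.
have cF : {within box lo hi, continuous (fun x => `|f x|)}.
  apply: continuous_in_subspaceT => x; rewrite inE => bx.
  by apply: continuous_comp; [exact: cf|exact: norm_continuous].
have [m _ mF] := compact_EVT_max ne (@compact_box lo hi) cF.
by exists `|f m| => x bx; apply: mF; rewrite inE.
Qed.

End Laplacian.

(** * The maximum principle on boxes *)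
Section Comparison.
Variables (R : realType) (n : nat).
Implicit Types (f g : 'rV[R]_n.+1 -> R) (x : 'rV[R]_n.+1).

(** At an interior minimum all pure second derivatives are nonnegative, which a
    small strictly superharmonic perturbation of [f] forbids. *)
Lemma comparison (lo hi : 'rV[R]_n.+1) f :
  (forall x, box lo hi x -> cont f x) ->
  (forall x, (forall i, lo 0 i < x 0 i < hi 0 i) -> exists2 L, L <= 0 & lap f x L) ->
  (forall x i, box lo hi x -> x 0 i = lo 0 i \/ x 0 i = hi 0 i -> 0 <= f x) ->
  forall x, box lo hi x -> 0 <= f x.
Proof.
move=> cf lf bf x bx; rewrite leNgt; apply/negP => fx0.
pose w := hi 0 ord0 - lo 0 ord0.
have w0 : 0 <= w by rewrite /w subr_ge0; have /andP[] := bx ord0; exact: le_trans.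
(* Small enough for the perturbation to keep the value at [x] negative. *)
pose e := - f x / (w ^+ 2 + 1) / 2.
have w1 : 0 < w ^+ 2 + 1 by rewrite ltr_wpDl// sqr_ge0.
have e0 : 0 < e by rewrite /e !divr_gt0// oppr_gt0.
have ew : e * w ^+ 2 < - f x.
  have -> : - f x = e * (w ^+ 2 + 1) * 2.
    by rewrite /e; field; rewrite gt_eqF.
  by nra.
pose q (s : R) := w ^+ 2 - (s - lo 0 ord0) * (s - lo 0 ord0).
pose F z := f z + e * q (z 0 ord0).
have cq (z : 'rV[R]_n.+1) : cont (fun z : 'rV[R]_n.+1 => q (z 0 ord0)) z.
  apply: contB; first exact: cont_cst.
  by apply: contM; (apply: contB; [exact: cont_coord|exact: cont_cst]).
have cF : {within box lo hi, continuous F}.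
  apply: continuous_in_subspaceT => z; rewrite inE => bz.
  by apply: contD; [exact: cf|apply: contM (cq z); exact: cont_cst].
have bne : box lo hi !=set0 by exists x.
have [m bm mF] := compact_EVT_min bne (@compact_box _ _ lo hi) cF.
rewrite inE in bm.
have qge z : box lo hi z -> 0 <= q (z 0 ord0).
  move=> /(_ ord0)/andP[h1 h2]; rewrite subr_ge0 -expr2 lerXn2r// ?nnegrE ?subr_ge0//.
  by rewrite lerD2r.
have Fm0 : F m < 0.
  have := mF x; rewrite inE => /(_ bx) /le_lt_trans; apply.
  rewrite /F /q; have := sqr_ge0 (x 0 ord0 - lo 0 ord0); rewrite expr2; nra.
have fm0 : f m < 0.
  move: Fm0; rewrite /F; have := qge _ bm; nra.
have mi i : lo 0 i < m 0 i < hi 0 i.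
  have /andP[h1 h2] := bm i; rewrite !lt_neqAle h1 h2 !andbT.
  apply/andP; split; apply/eqP => E; move: fm0; rewrite ltNge => /negP; apply.
    by apply: (bf m i) => //; left.
  by apply: (bf m i) => //; right.
have [L L0 lfm] := lf m mi.
have sq : sder q (m 0 ord0) (- 2).
  apply: (@sder_everywhere _ _ (fun s => 2 * lo 0 ord0 + (-2) * s)); last exact: is_derive_affine.
  move=> t; have h : is_derive t 1 (fun s : R => s - lo 0 ord0) 1.
    by rewrite -{2}(subr0 1); apply: is_deriveB.
  have := is_deriveB (is_derive_cst (w ^+ 2) t 1) (is_deriveM h h).
  by rewrite (_ : _ - _ = 2 * lo 0 ord0 + -2 * t) // /GRing.scale /=; ring.
have [l [Fl lL]] : lap F m (L + e * - 2).
  by apply: lapD => //; apply: lapZ; exact: lap_coord.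
have : 0 <= L + e * - 2.
  rewrite -lL sumr_ge0// => i _.
  apply: (sder_ge0_at_min (Fl i)); rewrite line0.
  have Hi : \forall s \near (0 : R), lo 0 i < line m i s 0 i < hi 0 i.
    have c := @cvg_line R n.+1 m i 0; rewrite line0 in c.
    have N : nbhs (m 0 i) [set s | lo 0 i < s < hi 0 i].
      have : m 0 i \in `]lo 0 i, hi 0 i[ by rewrite in_itv /= mi.
      by move=> /near_in_itvoo; apply: filterS => s; rewrite in_itv.
    exact: (c _ (@cont_coord R n.+1 m i _ N)).
  apply: filterS Hi => s hs; apply: mF; rewrite inE => j.
  have [<-|ij] := eqVneq i j; last by rewrite line_off//; apply: bm.
  by move: hs => /andP[/ltW-> /ltW->].
by lra.
Qed.

End Comparison.

(** * Quadratic barriers and finite differences *)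
Section QuadraticBarrier.
Variables (R : realType) (n : nat).
Implicit Types (f g : 'rV[R]_n.+1 -> R) (x z : 'rV[R]_n.+1).

Lemma sum_lateral_cst (c : R) : \sum_(i < n.+1 | i != ord0) c = n%:R * c.
Proof.
by rewrite sumr_const (_ : #|_| = n) ?mulr_natl// cardC1 card_ord.
Qed.

(** Harmonic, as the [n] lateral squares and the quadratic in the height have
    opposite Laplacians; nonnegative on the base of the box of half width [r] and
    height [H] over [x], at least 1 on the other faces, and linear in the height
    above the centre. The linear coefficient makes it at least 1 at the top. *)
Definition lateral_barrier x (r H : R) z : R :=
  \sum_(i | i != ord0) ((z 0 i - x 0 i) / r) ^+ 2 +
  (z 0 ord0 - x 0 ord0) *
    ((n%:R * H / r ^+ 2 + H^-1) - n%:R / r ^+ 2 * (z 0 ord0 - x 0 ord0)).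

Lemma cont_sqr (f : 'rV[R]_n.+1 -> R) x : cont f x -> cont (fun z => f z ^+ 2) x.
Proof.
rewrite (_ : (fun z => f z ^+ 2) = fun z => f z * f z).
  by move=> cf; exact: contM.
by apply/funext => z; rewrite expr2.
Qed.

Lemma harm_lateral_barrier x (r H : R) z : 0 < r -> 0 < H ->
  harm (lateral_barrier x r H) z.
Proof.
move=> r0 H0; split.
  apply: contD.
    apply: cont_sum => i _; apply: cont_sqr.
    by apply: contM; [apply: contB; [exact: cont_coord|]|]; exact: cont_cst.
  apply: contM; first by apply: contB; [exact: cont_coord|exact: cont_cst].
  apply: contB; first exact: cont_cst.
  apply: contM; first exact: cont_cst.
  by apply: contB; [exact: cont_coord|exact: cont_cst].
have r0' : r != 0 by rewrite gt_eqF.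
apply: lap_eq.
  apply: lapD.
    apply: lap_sum => i _.
    apply: (lap_coord (q := fun s => ((s - x 0 i) / r) ^+ 2)).
    apply: (@sder_quadratic _ _ ((x 0 i / r) ^+ 2) (- 2 * x 0 i / r ^+ 2) (r ^- 2)).
    by move=> t; field.
  pose L := n%:R * H / r ^+ 2 + H^-1.
  apply: (lap_coord (q := fun s => (s - x 0 ord0) * (L - n%:R / r ^+ 2 * (s - x 0 ord0)))).
  apply: (@sder_quadratic _ _
    (- x 0 ord0 * (L + n%:R / r ^+ 2 * x 0 ord0)) (L + 2 * (n%:R / r ^+ 2 * x 0 ord0))
    (- (n%:R / r ^+ 2))).
  by move=> t; ring.
by rewrite sum_lateral_cst; ring.
Qed.

Lemma linear_vanishing_half f x (r H K : R) : 0 < r -> 0 < H -> 0 <= K ->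
  (forall z, x 0 ord0 <= z 0 ord0 <= x 0 ord0 + H ->
     (forall i, i != ord0 -> `|z 0 i - x 0 i| <= r) ->
     [/\ harm f z, f z <= K & z 0 ord0 = x 0 ord0 -> f z <= 0]) ->
  forall s, 0 <= s <= H ->
  f (line x ord0 s) <= K * (n%:R * H / r ^+ 2 + H^-1) * s.
Proof.
move=> r0 H0 K0 hf s /andP[s0 sH].
pose lo : 'rV[R]_n.+1 := \row_j if j == ord0 then x 0 ord0 else x 0 j - r.
pose hi : 'rV[R]_n.+1 := \row_j if j == ord0 then x 0 ord0 + H else x 0 j + r.
have boxP z : box lo hi z -> x 0 ord0 <= z 0 ord0 <= x 0 ord0 + H /\
    forall i, i != ord0 -> `|z 0 i - x 0 i| <= r.
  move=> bz; split; first by have := bz ord0; rewrite !mxE eqxx.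
  move=> i i0; have := bz i; rewrite !mxE (negPf i0) ler_norml.
  by move=> /andP[? ?]; apply/andP; split; lra.
pose B := lateral_barrier x r H.
have sq0 z : 0 <= \sum_(i | i != ord0) ((z 0 i - x 0 i) / r) ^+ 2.
  by apply: sumr_ge0 => i _; exact: sqr_ge0.
have nr : 0 <= n%:R / r ^+ 2 by rewrite divr_ge0// sqr_ge0.
have Hi : 0 < H^-1 by rewrite invr_gt0.
have t0 (t : R) : 0 <= t -> t <= H ->
    0 <= t * ((n%:R * H / r ^+ 2 + H^-1) - n%:R / r ^+ 2 * t).
  move=> t0 tH; apply: mulr_ge0 => //.
  rewrite (_ : _ - _ = n%:R / r ^+ 2 * (H - t) + H^-1); last by ring.
  by rewrite addr_ge0 ?(ltW Hi)// mulr_ge0// subr_ge0.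
have key : 0 <= K * B (line x ord0 s) - f (line x ord0 s).
  apply: (@comparison _ _ lo hi (fun z => K * B z - f z)).
  - move=> z /boxP[b1 b2]; have [[cf _] _ _] := hf z b1 b2.
    apply: contB => //; apply: contM; first exact: cont_cst.
    by have [] := @harm_lateral_barrier x r H z r0 H0.
  - move=> z bz; exists 0 => //.
    have [b1 b2] : x 0 ord0 <= z 0 ord0 <= x 0 ord0 + H /\
        forall i, i != ord0 -> `|z 0 i - x 0 i| <= r.
      by apply: boxP => i; have /andP[/ltW-> /ltW->] := bz i.
    have [[_ lf] _ _] := hf z b1 b2.
    have [_ lB] := @harm_lateral_barrier x r H z r0 H0.
    by rewrite -(subr0 0); apply: lapB lf; rewrite -(mulr0 K); exact: lapZ.
  - move=> z i bz zi; have [b1 b2] := boxP _ bz.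
    have [_ fK f0] := hf z b1 b2; move: b1 => /andP[b11 b12].
    have Bge : 0 <= B z.
      by apply: addr_ge0; [exact: sq0|apply: t0; lra].
    have [i0|i0] := eqVneq i ord0; last first.
      have : 1 <= B z.
        apply: (@le_trans _ _ (\sum_(i | i != ord0) ((z 0 i - x 0 i) / r) ^+ 2)).
          rewrite (bigD1 i)//= -[leLHS]addr0; apply: lerD.
            by move: zi; rewrite !mxE (negPf i0) => -[->|->];
              rewrite -addrAC subrr add0r ?mulNr ?sqrrN divff ?expr1n ?gt_eqF.
          by apply: sumr_ge0 => j _; exact: sqr_ge0.
        by rewrite lerDl; apply: t0; lra.
      by nra.
    move: zi; rewrite i0 !mxE eqxx => -[zi|zi].
      by have := f0 zi; nra.
    have : 1 <= B z.
      apply: (@le_trans _ _ (H * H^-1)); first by rewrite divff// gt_eqF.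
      rewrite -[leLHS]add0r; apply: lerD; first exact: sq0.
      rewrite zi (_ : x 0 ord0 + H - x 0 ord0 = H); last by ring.
      by rewrite (_ : H * (_ - _) = H * H^-1)//; ring.
    by nra.
  - move=> i; have [->|i0] := eqVneq i ord0.
      by rewrite line_diag [lo _ _]mxE [hi _ _]mxE eqxx; apply/andP; split; lra.
    rewrite line_off 1?eq_sym// [lo _ _]mxE [hi _ _]mxE (negPf i0).
    by apply/andP; split; lra.
rewrite -subr_ge0; apply: le_trans key _; rewrite lerD2r -mulrA ler_wpM2l//.
rewrite /B /lateral_barrier big1 ?add0r => [|i i0]; last first.
  by rewrite line_off 1?eq_sym// subrr mul0r expr0n.
rewrite line_diag (_ : x 0 ord0 + s - x 0 ord0 = s); last by ring.
rewrite [leRHS]mulrC ler_wpM2l// lerBlDr lerDl mulr_ge0//.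
Qed.

(** Comparison of [f] and [- f] with [K * lateral_barrier]. *)
Lemma linear_vanishing f x (r H K : R) : 0 < r -> 0 < H ->
  (forall z, x 0 ord0 <= z 0 ord0 <= x 0 ord0 + H ->
     (forall i, i != ord0 -> `|z 0 i - x 0 i| <= r) ->
     [/\ harm f z, `|f z| <= K & z 0 ord0 = x 0 ord0 -> f z = 0]) ->
  forall s, 0 <= s <= H ->
  `|f (line x ord0 s)| <= K * (n%:R * H / r ^+ 2 + H^-1) * s.
Proof.
move=> r0 H0 hf s sH.
have K0 : 0 <= K.
  have [||_ + _] := hf x; first by rewrite lexx lerDl ltW.
    by move=> i _; rewrite subrr normr0 ltW.
  exact: le_trans.
rewrite ler_norml lerNl; apply/andP; split.
  apply: (@linear_vanishing_half (fun z => - f z)) => // z b1 b2.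
  have [h1 h2 h3] := hf z b1 b2; split; first exact: harmN.
    by apply: le_trans h2; rewrite -normrN ler_norm.
  by move=> /h3->; rewrite oppr0.
apply: linear_vanishing_half => // z b1 b2.
have [h1 h2 h3] := hf z b1 b2; split=> //; first exact: le_trans (ler_norm _) h2.
by move=> /h3->.
Qed.

(** The difference between the values at two mirror points is odd across the
    mirror, so it vanishes there and [linear_vanishing] applies. In this form a
    gradient estimate can be iterated: differences of [f] are again harmonic. *)
Lemma harmonic_difference_le f x (r M : R) : 0 < r ->
  (forall z, (forall i, `|z 0 i - x 0 i| <= r) -> harm f z /\ `|f z| <= M) ->
  forall s, 0 <= s <= r ->
  `|f (line x ord0 s) - f (line x ord0 (- s))| <= 2 * M * (n.+1%:R / r) * s.
Proof.
move=> r0 hf s sr.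
pose fl := @flip R n.+1 ord0 (2 * x 0 ord0) (-1).
have flE z i : `|fl z 0 i - x 0 i| = `|z 0 i - x 0 i|.
  have [<-|i0] := eqVneq ord0 i; last by rewrite flip_off.
  rewrite flip_diag -(normrN (z 0 ord0 - _)); congr (`| _ |); ring.
have fll : fl (line x ord0 s) = line x ord0 (- s).
  rewrite /fl flip_line eqxx mulN1r; congr line.
  rewrite /flip (_ : _ + _ = 0) ?line0//; ring.
have -> : 2 * M * (n.+1%:R / r) = 2 * M * (n%:R * r / r ^+ 2 + r^-1).
  by rewrite -natr1; field; rewrite gt_eqF.
rewrite -fll; apply: (@linear_vanishing (fun z => f z - f (fl z))) => // z b1 b2.
have bz i : `|z 0 i - x 0 i| <= r.
  have [->|/b2//] := eqVneq i ord0.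
  by rewrite ler_norml; apply/andP; split; lra.
have [h1 m1] := hf z bz.
have [h2 m2] : harm f (fl z) /\ `|f (fl z)| <= M.
  by apply: hf => i; rewrite flE.
split.
- by apply: harmB => //; apply: harm_flip => //; rewrite sqrrN expr1n.
- by apply: le_trans (ler_normB _ _) _; lra.
- move=> z0; rewrite (_ : fl z = z) ?subrr// /fl /flip z0.
  by rewrite (_ : _ + _ = 0) ?line0//; ring.
Qed.
End QuadraticBarrier.

(** * Unique continuation *)
Section UniqueContinuation.
Variables (R : realType) (n : nat).
Implicit Types (f g : 'rV[R]_n.+1 -> R) (x z : 'rV[R]_n.+1).

Definition backdiff (s : R) f z : R := f z - f (line z ord0 (- s)).

Lemma harm_line f z (a : R) : harm f (line z ord0 a) ->
  harm (fun w => f (line w ord0 a)) z.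
Proof.
have E w : flip ord0 a 1 w = line w ord0 a by rewrite /flip subrr mul0r addr0.
move=> h; have := @harm_flip R n.+1 ord0 a 1 f z (expr1n _ _).
by rewrite E => /(_ h); under [X in harm X]eq_fun do rewrite E.
Qed.

(** Each difference costs a margin [2 r] of the cube and gains a factor [s (n+1) / r],
    by [harmonic_difference_le] at the midpoint of the two points involved. *)
Lemma backdiff_bound f x (rho r s M : R) (m : nat) :
  0 < r -> 0 <= s <= r ->
  (forall z, (forall i, `|z 0 i - x 0 i| <= rho) -> harm f z /\ `|f z| <= M) ->
  forall k z, (forall i, `|z 0 i - x 0 i| <= rho - 2 * k%:R * r) ->
  harm (iter k (backdiff s) f) z /\
  `|iter k (backdiff s) f z| <= (n.+1%:R * s / r) ^+ k * M.
Proof.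
move=> r0 /andP[s0 sr] hf; elim=> [|k IH] z hz.
  rewrite expr0 mul1r /=; apply: hf => i.
  by apply: le_trans (hz i) _; rewrite mulr0 mul0r subr0.
have hk : rho - 2 * k.+1%:R * r = rho - 2 * k%:R * r - 2 * r.
  by rewrite -natr1; ring.
have nearz (a : R) (w : 'rV[R]_n.+1) : `|a| <= s -> (forall i, `|w 0 i - line z ord0 a 0 i| <= r) ->
    forall i, `|w 0 i - x 0 i| <= rho - 2 * k%:R * r.
  move=> ha hw i; have := hw i; have := hz i; rewrite hk lineE.
  have : `|a * (ord0 == i)%:R| <= s.
    by case: eqVneq => _; rewrite ?mulr1// mulr0 normr0.
  rewrite !ler_norml => /andP[? ?] /andP[? ?] /andP[? ?].
  by apply/andP; split; lra.
set g := iter k _ f in IH *.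
have hzr a : `|a| <= s -> forall i, `|line z ord0 a 0 i - x 0 i| <= rho - 2 * k%:R * r.
  by move=> ha; apply: (nearz a (line z ord0 a) ha) => i; rewrite subrr normr0 ltW.
split.
  apply: harmB; first by apply: (IH _ _).1; have := hzr 0; rewrite line0 normr0; apply.
  by apply: harm_line; apply: (IH _ _).1; apply: hzr; rewrite normrN ger0_norm.
pose c := line z ord0 (- (s / 2)).
have -> : iter k.+1 (backdiff s) f z =
    g (line c ord0 (s / 2)) - g (line c ord0 (- (s / 2))).
  by rewrite !line_line addNr line0 -opprD -splitr.
have := @harmonic_difference_le R n g c r ((n.+1%:R * s / r) ^+ k * M) r0.
have -> : (n.+1%:R * s / r) ^+ k.+1 * M =
    2 * ((n.+1%:R * s / r) ^+ k * M) * (n.+1%:R / r) * (s / 2).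
  by rewrite exprS; field; rewrite gt_eqF.
apply; last by apply/andP; split; lra.
move=> w hw; apply: IH; apply: nearz hw.
by rewrite normrN ger0_norm; lra.
Qed.

Lemma backdiff_zero f x (rho s : R) : 0 <= s ->
  (forall t, - rho <= t <= 0 -> f (line x ord0 t) = 0) ->
  forall k t, - rho <= t - k%:R * s -> t <= 0 ->
  iter k (backdiff s) f (line x ord0 t) = 0.
Proof.
move=> s0 hf; elim=> [|k IH] t h1 h2 /=.
  by apply: hf; rewrite h2 andbT; move: h1; rewrite mul0r subr0.
move: h1; rewrite -natr1 mulrDl mul1r => h1.
have ks : 0 <= k%:R * s by rewrite mulr_ge0.
rewrite /backdiff line_line !IH ?subr0//; lra.
Qed.

(** A function that vanishes at [0] and below is recovered from its backward
    differences of order [m] by [m] summations; the weight doubles with each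
    summation and with each grid point. *)
Lemma backward_sum_bound (a : nat -> nat -> R) (m : nat) (C : R) : 0 <= C ->
  (forall k, (k <= m)%N -> a k 0%N = 0) ->
  (forall k j, a k.+1 j.+1 = a k j.+1 - a k j) ->
  (forall j, (j <= m)%N -> `|a m j| <= C) ->
  forall p k j, (k + p = m)%N -> (j <= m)%N -> `|a k j| <= C * 2 ^+ (j + p).
Proof.
move=> C0 a0 aS am; elim=> [|p IH] k j.
  rewrite addn0 => -> jm; apply: le_trans (am _ jm) _.
  by rewrite ler_peMr// addn0 exprn_ege1// ler1n.
move=> kp; elim: j => [|j IHj] jm.
  by rewrite a0 ?normr0 ?mulr_ge0 ?exprn_ge0// -kp leq_addr.
have -> : a k j.+1 = a k j + a k.+1 j.+1 by rewrite aS; ring.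
apply: le_trans (ler_normD _ _) _.
apply: le_trans (lerD (IHj (ltnW jm)) (IH k.+1 j.+1 _ jm)) _.
  by rewrite addSnnS.
have -> : (j.+1 + p.+1 = (j.+1 + p).+1)%N by rewrite addnS.
have -> : (j + p.+1 = j.+1 + p)%N by rewrite addnS addSn.
by rewrite exprS le_eqVlt; apply/orP; left; apply/eqP; ring.
Qed.

Lemma vanish_of_geometric (y M : R) :
  (forall m : nat, (0 < m)%N -> `|y| * 2 ^+ m <= M) -> y = 0.
Proof.
move=> h; apply/eqP; rewrite -normr_eq0 -[_ == 0]negbK; apply/negP => y0.
have yp : 0 < `|y| by rewrite lt_neqAle eq_sym y0 normr_ge0.
have [m hm] : exists m : nat, M / `|y| < m%:R.
  exists (Num.bound `|M / `|y| |).
  by apply: le_lt_trans (ler_norm _) _; exact/archi_boundP/normr_ge0.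
have := h m.+1 isT; apply/negP; rewrite -ltNge mulrC -ltr_pdivrMr//.
apply: lt_trans hm _; rewrite -natrX ltr_nat.
by apply: leq_trans (ltn_expl m.+1 (ltnSn 1)).
Qed.

Lemma cube_bounded f x (rho : R) :
  (forall z, (forall i, `|z 0 i - x 0 i| <= rho) -> cont f z) ->
  exists M, forall z, (forall i, `|z 0 i - x 0 i| <= rho) -> `|f z| <= M.
Proof.
move=> cf.
pose lo : 'rV[R]_n.+1 := \row_j (x 0 j - rho).
pose hi : 'rV[R]_n.+1 := \row_j (x 0 j + rho).
have bP z : box lo hi z <-> (forall i, `|z 0 i - x 0 i| <= rho).
  by split=> h i; have := h i; rewrite !mxE ler_norml => /andP[? ?];
    apply/andP; split; lra.
have [M hM] := @box_bounded _ _ f lo hi (fun z bz => cf z ((bP z).1 bz)).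
by exists M => z /bP; exact: hM.
Qed.

(** The difference of order [m] is at most [8^-m * M], and summing it back [m]
    times over [m] grid points costs [4^m]; [m] is arbitrary. *)
Lemma unique_continuation_step f x (rho t : R) : 0 < rho ->
  0 <= t <= rho / (32 * n.+1%:R) ->
  (forall z, (forall i, `|z 0 i - x 0 i| <= rho) ->
    harm f z /\ (z 0 ord0 <= x 0 ord0 -> f z = 0)) ->
  f (line x ord0 t) = 0.
Proof.
move=> rho0 /andP[t0 tr] hf.
have [M hM] : exists M, forall z, (forall i, `|z 0 i - x 0 i| <= rho) -> `|f z| <= M.
  by apply: cube_bounded => z /hf[[]].
have M0 : 0 <= M.
  by apply: le_trans (normr_ge0 _) (hM x _) => i; rewrite subrr normr0 ltW.
have N0 : 1 <= n.+1%:R :> R by rewrite ler1n.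
have tN : t * (32 * n.+1%:R) <= rho by rewrite -ler_pdivlMr//; lra.
have trho : t <= rho / 4 by nra.
apply: (@vanish_of_geometric _ M) => m m0.
have mR : 0 < m%:R :> R by rewrite ltr0n.
(* With [m] steps of length [s], margins [2 r] that use up half of the cube, and
   [t] small against [rho], the factor of one difference is at most 1/8. *)
pose s := t / m%:R; pose r := rho / (4 * m%:R).
have r0 : 0 < r by rewrite divr_gt0//; lra.
have s0 : 0 <= s by rewrite divr_ge0// ltW.
have ms : m%:R * s = t by rewrite /s; field; rewrite gt_eqF.
have mr : 2 * m%:R * r = rho / 2 by rewrite /r; field; rewrite gt_eqF.
have sr : s <= r by rewrite -(ler_pM2l mR) ms; lra.
have theta : n.+1%:R * s / r <= 8^-1.
  have -> : n.+1%:R * s / r = 4 * (t * n.+1%:R) / rho.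
    by rewrite /s /r; field; rewrite !gt_eqF.
  by rewrite ler_pdivrMr//; lra.
have theta0 : 0 <= n.+1%:R * s / r by rewrite divr_ge0 ?mulr_ge0// ltW.
have onaxis a i : `|line x ord0 a 0 i - x 0 i| <= `|a|.
  have [<-|i0] := eqVneq ord0 i; last by rewrite line_off// subrr normr0.
  by rewrite line_diag (_ : x 0 ord0 + a - x 0 ord0 = a)//; ring.
have fz a : - rho <= a <= 0 -> f (line x ord0 a) = 0.
  move=> /andP[a1 a2]; apply: (hf _ _).2; last by rewrite line_diag; lra.
  by move=> i; apply: le_trans (onaxis a i) _; rewrite ler_norml; apply/andP; split; lra.
pose a k j := iter k (backdiff s) f (line x ord0 (j%:R * s)).
have js j : (j <= m)%N -> 0 <= j%:R * s <= t.
  by move=> jm; rewrite mulr_ge0//= -ms ler_wpM2r// ler_nat.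
have := @backward_sum_bound a m ((8^-1) ^+ m * M) _ _ _ _ m 0%N m (add0n m) (leqnn m).
rewrite /a /= ms => H.
have {}H : `|f (line x ord0 t)| <= 8^-1 ^+ m * M * 2 ^+ (m + m).
  apply: H => [|k km|k j|j jm].
  - by rewrite mulr_ge0// exprn_ge0.
  - rewrite mul0r; apply: (@backdiff_zero _ _ rho) => //.
    by rewrite sub0r; have /andP[_] := js _ km; lra.
  - rewrite /= /backdiff line_line; congr (_ - iter k _ f (line x ord0 _)).
    by rewrite -natr1; ring.
  - have [|||_] := @backdiff_bound f x rho r s M m r0 _ _ m (line x ord0 (j%:R * s)).
    + by rewrite s0.
    + by move=> z hz; split; [apply: (hf z hz).1|exact: hM].
    + move=> i; apply: le_trans (onaxis _ i) _; rewrite mr.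
      by have /andP[? ?] := js _ jm; rewrite ger0_norm//; lra.
    move=> /le_trans; apply; rewrite ler_wpM2r//.
    by rewrite lerXn2r// nnegrE.
have p2 : 0 < 2 ^+ m :> R by rewrite exprn_gt0.
rewrite -(ler_pM2r (_ : 0 < (2 ^+ m)^-1))  ?invr_gt0// mulfK ?gt_eqF//.
apply: le_trans H _; rewrite exprD exprVn.
have -> : 8 ^+ m = 2 ^+ m * 2 ^+ m * 2 ^+ m :> R.
  by rewrite -!exprMn; congr (_ ^+ _); ring.
rewrite le_eqVlt; apply/orP; left; apply/eqP; field.
by rewrite gt_eqF.
Qed.

(** The step length in [unique_continuation_step] depends only on the distance to
    the boundary of the strip, so finitely many steps reach any point. *)
Lemma unique_continuation f (alpha beta T : R) : alpha < T -> T < beta ->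
  (forall z, alpha < z 0 ord0 < beta -> harm f z) ->
  (forall z, alpha < z 0 ord0 <= T -> f z = 0) ->
  forall z, alpha < z 0 ord0 < beta -> f z = 0.
Proof.
move=> aT Tb hf f0 z0 /andP[az zb].
have [zT|Tz] := leP (z0 0 ord0) T; first by apply: f0; rewrite az.
pose rho := Num.min (T - alpha) (beta - z0 0 ord0) / 2.
have m0 : 0 < Num.min (T - alpha) (beta - z0 0 ord0) by rewrite lt_min !subr_gt0 aT.
have rho0 : 0 < rho by rewrite divr_gt0.
have [rho1 rho2] : rho < T - alpha /\ rho < beta - z0 0 ord0.
  have : rho < Num.min (T - alpha) (beta - z0 0 ord0) by rewrite /rho; lra.
  by rewrite lt_min => /andP.
pose tau := rho / (32 * n.+1%:R).
have tau0 : 0 < tau by rewrite divr_gt0// mulr_gt0// ltr0n.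
have step (k : nat) (w : 'rV[R]_n.+1) : alpha < w 0 ord0 -> w 0 ord0 <= z0 0 ord0 ->
    w 0 ord0 <= T + k%:R * tau -> f w = 0.
  elim: k w => [|k IH] w aw wz.
    by rewrite mul0r addr0 => wT; apply: f0; rewrite aw.
  have [wk _|kw] := leP (w 0 ord0) (T + k%:R * tau); first exact: IH.
  rewrite -natr1 mulrDl mul1r => wk.
  have kt : 0 <= k%:R * tau by rewrite mulr_ge0// ltW.
  pose x := line w ord0 (T + k%:R * tau - w 0 ord0).
  have x0 : x 0 ord0 = T + k%:R * tau by rewrite line_diag; ring.
  have -> : w = line x ord0 (w 0 ord0 - (T + k%:R * tau)).
    by rewrite line_line (_ : _ + _ = 0) ?line0//; ring.
  apply: (@unique_continuation_step _ _ rho) => //.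
    by rewrite -/tau; apply/andP; split; lra.
  move=> z hz; have := hz ord0; rewrite x0 ler_norml => /andP[h1 h2]; split.
    by apply: hf; apply/andP; split; lra.
  by move=> h3; apply: IH; lra.
have [m hm] : exists m : nat, (z0 0 ord0 - T) / tau < m%:R.
  exists (Num.bound `|(z0 0 ord0 - T) / tau|).
  by apply: le_lt_trans (ler_norm _) _; exact/archi_boundP/normr_ge0.
apply: (step m) => //; rewrite ltr_pdivrMr// in hm; lra.
Qed.

End UniqueContinuation.

(** * Primitives in the first coordinate *)
Section ParametricIntegral.
Variables (R : realType) (n : nat).
Notation mu := (@lebesgue_measure R).
Implicit Types (phi : 'rV[R]_n.+1 -> R) (x z : 'rV[R]_n.+1).

Lemma contP phi z : (forall e : R, 0 < e ->
  \forall y \near z, `|phi z - phi y| <= e) <-> cont phi z.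
Proof.
split=> [h|h]; first exact: ((@cvgrPdist_le _ _ _ (nbhs z) _ phi (phi z)).2 h).
exact: ((@cvgrPdist_le _ _ _ (nbhs z) _ phi (phi z)).1 h).
Qed.

Definition put z (t : R) : 'rV[R]_n.+1 := line z ord0 (t - z 0 ord0).

Lemma put_diag z t : put z t 0 ord0 = t.
Proof. by rewrite line_diag; ring. Qed.

Lemma put_off z t i : i != ord0 -> put z t 0 i = z 0 i.
Proof. by move=> i0; rewrite line_off// eq_sym. Qed.

Lemma put_id z : put z (z 0 ord0) = z.
Proof. by rewrite /put subrr line0. Qed.

Lemma put_line0 z s t : put (line z ord0 s) t = put z t.
Proof. by rewrite /put line_line line_diag; congr line; ring. Qed.

Lemma line_put z s t : line (put z t) ord0 s = put z (t + s).
Proof. by rewrite /put line_line; congr line; ring. Qed.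

Lemma put_line z i s t : i != ord0 -> put (line z i s) t = line (put z t) i s.
Proof.
by move=> i0; rewrite /put /line line_off// -addrA (addrC (_ *: _)) addrA.
Qed.

Lemma cvg_put z (t : R) :
  put p.2 p.1 @[p --> ((t, z) : R * 'rV[R]_n.+1)] --> put z t.
Proof.
have c2 : (p : R * 'rV[R]_n.+1).2 @[p --> (t, z)] --> z by exact: cvg_snd.
have c1 : (p : R * 'rV[R]_n.+1).1 @[p --> (t, z)] --> t by exact: cvg_fst.
have c3 : (p : R * 'rV[R]_n.+1).2 0 ord0 @[p --> (t, z)] --> z 0 ord0.
  exact: (@cvg_comp _ _ _ _ (fun z : 'rV[R]_n.+1 => z 0 ord0) _ _ _ c2 (@cont_coord R n.+1 z ord0)).
exact: (cvgD c2 (cvgZr_tmp (cvgB c1 c3))).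
Qed.

Variables (b' b : R).
Hypotheses (b0 : 0 < b) (bb' : b < b').

Definition cont_strip phi := forall z, - b' < z 0 ord0 < b' -> cont phi z.

Lemma cont_put phi z : cont_strip phi -> forall t : R, - b <= t <= b ->
  {for t, continuous (fun t => phi (put z t))}.
Proof.
have B0 := b0; have B1 := bb'.
move=> cphi t /andP[t1 t2].
have c : put z u @[u --> t] --> put z t.
  have c1 : (u - z 0 ord0) @[u --> t] --> t - z 0 ord0.
    exact: (cvgB cvg_id (cvg_cst _)).
  exact: (cvgD (cvg_cst z) (cvgZr_tmp c1)).
apply: (cvg_comp _ _ c); apply: cphi.
by rewrite put_diag; apply/andP; split; lra.
Qed.

Lemma integrable_put phi z t : cont_strip phi -> t <= b ->
  mu.-integrable `[- b, t] (EFin \o (fun u => phi (put z u))).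
Proof.
have B0 := b0; have B1 := bb'.
move=> cphi tb; apply: continuous_compact_integrable; first exact: segment_compact.
apply: continuous_in_subspaceT => u; rewrite inE /= in_itv /= => /andP[u1 u2].
by apply: cont_put => //; apply/andP; split; lra.
Qed.

(** The integral starts at the fixed height [- b], inside the strip, so that its
    upper end can have either sign. *)
Definition primitive phi z (t : R) : R :=
  \int[mu]_(u in `[- b, t]) phi (put z u).

Lemma is_derive_primitive phi z (t : R) : cont_strip phi -> - b < t < b ->
  is_derive t 1 (primitive phi z) (phi (put z t)).
Proof.
have B0 := b0; have B1 := bb'.
move=> cphi /andP[t1 t2].
have [|||d e] := @continuous_FTC1_closed R (fun u => phi (put z u)) (- b) t b t2.
- exact: integrable_put.
- by [].
- by apply: cont_put => //; apply/andP; split; lra.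
by split; [exact: d|rewrite -derive1E].
Qed.

Lemma slab_bounded phi z (r : R) : cont_strip phi ->
  exists M : R, forall u : 'rV[R]_n.+1, - b <= u 0 ord0 <= b ->
    (forall i, i != ord0 -> `|u 0 i - z 0 i| <= r) -> `|phi u| <= M.
Proof.
have B0 := b0; have B1 := bb'.
move=> cphi.
pose lo : 'rV[R]_n.+1 := \row_j (if j == ord0 then - b else z 0 j - r).
pose hi : 'rV[R]_n.+1 := \row_j (if j == ord0 then b else z 0 j + r).
have bP u : box lo hi u <-> - b <= u 0 ord0 <= b /\
    (forall i, i != ord0 -> `|u 0 i - z 0 i| <= r).
  split=> [h|[h1 h2] i].
    split; first by have := h ord0; rewrite !mxE eqxx.
    move=> i i0; have := h i; rewrite !mxE (negPf i0) ler_norml => /andP[? ?].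
    by apply/andP; split; lra.
  rewrite !mxE; have [->//|i0] := eqVneq i ord0.
  by have := h2 i i0; rewrite ler_norml => /andP[? ?]; apply/andP; split; lra.
have [M hM] : exists M, forall u, box lo hi u -> `|phi u| <= M.
  apply: box_bounded => u /bP[/andP[u1 u2] _].
  by apply: cphi; apply/andP; split; lra.
by exists M => u u1 u2; apply: hM; apply/bP.
Qed.

(** Differentiation under the integral sign, with the domination given by the
    compactness of the slab around the line. *)
Lemma is_derive_primitive_lateral phi phi1 z (i : 'I_n.+1) (t : R) : i != ord0 ->
  cont_strip phi -> cont_strip phi1 ->
  (forall u : 'rV[R]_n.+1, - b' < u 0 ord0 < b' ->
     is_derive (0 : R) 1 (fun s => phi (line u i s)) (phi1 u)) ->
  - b < t <= b -> forall s : R, is_derive s 1 (fun s => primitive phi (line z i s) t)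
    (primitive phi1 (line z i s) t).
Proof.
have B0 := b0; have B1 := bb'.
move=> i0 cphi cphi1 d /andP[t1 t2] s0.
have strip (u : R) : - b <= u -> u <= t -> forall z, - b' < put z u 0 ord0 < b'.
  by move=> u1 u2 y; rewrite put_diag; apply/andP; split; lra.
have ds (s u : R) : - b <= u -> u <= t ->
    is_derive s 1 (fun s => phi (put (line z i s) u)) (phi1 (put (line z i s) u)).
  move=> u1 u2.
  have h := d _ (strip u u1 u2 (line z i s)).
  rewrite put_line// in h *; under eq_fun do rewrite put_line//.
  exact: is_derive_line.
have [M hM] : exists M, forall s u : R, s0 - 1 < s < s0 + 1 -> - b <= u <= t ->
    `|phi1 (put (line z i s) u)| <= M.
  have [M hM] := @slab_bounded phi1 (line z i s0) 1 cphi1.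
  exists M => s u /andP[s1 s2] /andP[u1 u2]; apply: hM.
    by rewrite put_diag u1; lra.
  move=> j j0; rewrite put_off// !lineE.
  rewrite (_ : _ - _ = (s - s0) * (i == j)%:R); last by ring.
  case: eqVneq => _; rewrite ?mulr0 ?normr0// mulr1 ler_norml.
  by apply/andP; split; lra.
pose f s u := phi (put (line z i s) u).
have dE s u : `[- b, t]%classic u -> partial1of2 f s u = phi1 (put (line z i s) u).
  rewrite /= in_itv /= => /andP[u1 u2]; rewrite partial1of2E.
  exact: (@derive_val _ _ _ _ _ _ _ (ds s u u1 u2)).
have M0 : 0 <= M.
  apply: le_trans (normr_ge0 _) (hM s0 t _ _); first by apply/andP; split; lra.
  by rewrite lexx andbT ltW.
have a1 : `]s0 - 1, s0 + 1[%classic s0 by rewrite /= in_itv /=; apply/andP; split; lra.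
have a2 : forall s, `]s0 - 1, s0 + 1[%classic s ->
  mu.-integrable `[- b, t] (EFin \o f s) by move=> s _; exact: integrable_put.
have a3 s u : `]s0 - 1, s0 + 1[%classic s -> `[- b, t]%classic u ->
    derivable (f ^~ u) s 1.
  move=> _; rewrite /= in_itv /= => /andP[u1 u2].
  exact: (@ex_derive _ _ _ _ _ _ _ (ds s u u1 u2)).
have a4 : mu.-integrable `[- b, t] (EFin \o cst M).
  apply: continuous_compact_integrable; first exact: segment_compact.
  by apply: continuous_in_subspaceT => u _; exact: cst_continuous.
have a5 s u : `]s0 - 1, s0 + 1[%classic s -> `[- b, t]%classic u ->
    `|partial1of2 f s u| <= cst M u.
  by move=> hs hu; rewrite dE//; apply: hM; move: hs hu; rewrite /= !in_itv.
have mB : measurable `[- b, t]%classic by exact: measurable_itv.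
have D := @derivable_under_integral R _ _ mu f _ mB s0 _ _ a1 a2 a3 _ (fun=> M0) a4 a5.
have E := @differentiation_under_integral R _ _ mu f _ mB s0 _ _ a1 a2 a3 _ (fun=> M0) a4 a5.
split; first exact: D.
rewrite -derive1E [LHS]E /primitive.
by apply: eq_Rintegral => u; rewrite inE => hu; exact: dE.
Qed.

(** By compactness of the interval of integration, [phi] is uniformly close to its
    values on the segment through [z]. *)
Lemma cont_primitive phi z (t : R) : cont_strip phi -> - b < t <= b ->
  cont (fun z => primitive phi z t) z.
Proof.
have B0 := b0; have B1 := bb'.
move=> cphi /andP[t1 t2]; apply/contP => e e0.
pose K := 2 * b + 1.
have K0 : 0 < K by rewrite /K; lra.
have : \forall y \near z, `[- b, t]%classic `<=`
    [set u | `|phi (put y u) - phi (put z u)| <= e / K].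
  have F : Filter (nbhs z) := nbhs_filter z.
  apply: ((compact_near_coveringP _).1 (@segment_compact R (- b) t) _ (nbhs z)
    (fun y u => `|phi (put y u) - phi (put z u)| <= e / K) F) => u; rewrite /= in_itv /= => /andP[u1 u2].
  have cp : phi (put p.2 p.1) @[p --> ((u, z) : R * 'rV[R]_n.+1)] --> phi (put z u).
    have H : cont phi (put z u).
      by apply: cphi; rewrite put_diag; apply/andP; split; lra.
    exact: (@cvg_comp _ _ _ (fun p : R * 'rV[R]_n.+1 => put p.2 p.1) phi _ _ _
      (@cvg_put z u) H).
  have cz : phi (put z p.1) @[p --> ((u, z) : R * 'rV[R]_n.+1)] --> phi (put z u).
    have c1 : (p : R * 'rV[R]_n.+1).1 @[p --> (u, z)] --> u by exact: cvg_fst.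
    have H : {for u, continuous (fun t => phi (put z t))}.
      by apply: cont_put => //; apply/andP; split; lra.
    exact: (@cvg_comp _ _ _ (fun p : R * 'rV[R]_n.+1 => p.1)
      (fun t => phi (put z t)) _ _ _ c1 H).
  have F2 : Filter (nbhs ((u, z) : R * 'rV[R]_n.+1)) := nbhs_filter _.
  have cpz : (fun p : R * 'rV[R]_n.+1 => phi (put p.2 p.1) - phi (put z p.1))
      @ nbhs ((u, z) : R * 'rV[R]_n.+1) --> (0 : R).
    by rewrite -(subrr (phi (put z u))); exact: (cvgB cp cz).
  exact: ((cvgr0Pnorm_le _).1 cpz _ (divr_gt0 e0 K0)).
apply: filterS => y hy.
rewrite /primitive -RintegralB//; [|exact: integrable_put|exact: integrable_put].
have iC (k : R) : mu.-integrable `[- b, t] (EFin \o cst k).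
  apply: continuous_compact_integrable; first exact: segment_compact.
  by apply: continuous_in_subspaceT => u _; exact: cst_continuous.
have iD : mu.-integrable `[- b, t]
    (EFin \o (fun u => phi (put z u) - phi (put y u))).
  apply: continuous_compact_integrable; first exact: segment_compact.
  apply: continuous_in_subspaceT => u; rewrite inE /= in_itv /= => /andP[u1 u2].
  by apply: cvgB; apply: (cont_put (phi := phi)) => //; apply/andP; split; lra.
apply: (le_trans (@le_normr_Rintegral _ _ _ mu _ _ (measurable_itv `[- b, t]) iD)).
apply: le_trans (@le_Rintegral _ _ _ mu `[- b, t] _ (cst (e / K)) (measurable_itv _) _ (iC _) _) _.
- have := integrable_norm iD.
  by [].
- by move=> u hu; rewrite distrC; exact: hy.
have mE : mu `[- b, t]%classic = (t + b)%:E.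
  apply: etrans (@lebesgue_measure_itv R `[- b, t]) _.
  by rewrite /= lte_fin t1 -EFinD opprK.
rewrite Rintegral_cst//; rewrite [X in fine X](_ : _ = (t + b)%:E) //= mulrAC ler_pdivrMr// ler_pM2l// /K; lra.
Qed.

(** The upper end moves too; near [z] the primitives are uniformly Lipschitz in it,
    because [phi] is bounded on a slab. *)
Lemma cont_primitive_diag phi z : cont_strip phi -> - b < z 0 ord0 < b ->
  cont (fun z => primitive phi z (z 0 ord0)) z.
Proof.
have B0 := b0; have B1 := bb'.
move=> cphi /andP[z1 z2].
have -> : (fun y => primitive phi y (y 0 ord0)) = fun y => primitive phi y (z 0 ord0) +
    (primitive phi y (y 0 ord0) - primitive phi y (z 0 ord0)).
  by apply/funext => y; ring.
have [M hM] := @slab_bounded phi z 1 cphi.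
have M0 : 0 <= M.
  apply: le_trans (normr_ge0 _) (hM z _ _); first by apply/andP; split; lra.
  by move=> i _; rewrite subrr normr0.
apply: contD; first by apply: cont_primitive => //; rewrite z1 ltW.
have cy i : cont (fun y : 'rV[R]_n.+1 => y 0 i) z := @cont_coord _ _ z i.
have F : Filter (nbhs z) := nbhs_filter z.
have N1 : \forall y \near z, forall i, `|(y : 'rV[R]_n.+1) 0 i - z 0 i| <= 1.
  apply: (@filter_forall _ _ (fun (i : 'I_n.+1) (y : 'rV[R]_n.+1) => `|y 0 i - z 0 i| <= 1) (nbhs z) F) => i.
  have /contP/(_ 1 ltr01) := cy i.
  by apply: filterS => y; rewrite distrC.
have N2 : \forall y \near z, - b < (y : 'rV[R]_n.+1) 0 ord0 < b.
  apply: (cy ord0 (fun s => - b < s < b)).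
  have : z 0 ord0 \in `]- b, b[ by rewrite in_itv /= z1.
  by move=> /near_in_itvoo; apply: filterS => s; rewrite in_itv.
apply/contP => e e0; rewrite subrr.
have Me : 0 < e / (M + 1) by rewrite divr_gt0// ltr_wpDl.
have /contP/(_ _ Me) N3 := cy ord0.
near=> y; rewrite sub0r normrN.
have h1 : forall i, `|y 0 i - z 0 i| <= 1 by near: y.
have /andP[h2 h2'] : - b < y 0 ord0 < b by near: y.
have h3 : `|z 0 ord0 - y 0 ord0| <= e / (M + 1) by near: y.
have lip (u v : R) : - b < u < b -> - b < v < b -> u < v ->
    `|primitive phi y v - primitive phi y u| <= M * (v - u).
  move=> /andP[u1 u2] /andP[v1 v2] uv.
  have dP w : u <= w -> w <= v -> is_derive w 1 (primitive phi y) (phi (put y w)).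
    by move=> w1 w2; apply: is_derive_primitive => //; apply/andP; split; lra.
  have [||w] := @MVT R (primitive phi y) (fun w => phi (put y w)) u v uv.
  - by move=> w; rewrite in_itv /= => /andP[w1 w2]; apply: dP; exact: ltW.
  - apply: derivable_within_continuous => w; rewrite in_itv /= => /andP[w1 w2].
    exact: (@ex_derive _ _ _ _ _ _ _ (dP w w1 w2)).
  rewrite in_itv /= => /andP[w1 w2] ->.
  have uv0 : 0 <= v - u by rewrite subr_ge0 ltW.
  rewrite normrM (ger0_norm uv0); apply: ler_wpM2r uv0 _ _ _.
  apply: hM; first by rewrite put_diag; apply/andP; split; lra.
  by move=> i i0; rewrite put_off.
have Me' : M * (e / (M + 1)) <= e.
  by rewrite mulrA ler_pdivrMr ?ltr_wpDl//; nra.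
have [->|yz] := eqVneq (y 0 ord0) (z 0 ord0); first by rewrite subrr normr0 ltW.
apply: le_trans Me'; apply: le_trans (ler_wpM2l M0 h3).
case: (ltgtP (y 0 ord0) (z 0 ord0)) => [lt|gt|/eqP]; last by rewrite (negPf yz).
- rewrite (@gtr0_norm _ (z 0 ord0 - y 0 ord0)) ?subr_gt0// distrC.
  by apply: lip; rewrite ?h2 ?z1.
- rewrite (distrC (z 0 ord0)) (@gtr0_norm _ (y 0 ord0 - z 0 ord0)) ?subr_gt0//.
  by apply: lip; rewrite ?h2 ?z1.
Unshelve. all: by end_near. Qed.

End ParametricIntegral.

(** * The factorisation of even biharmonic functions *)
Section Almansi.
Variables (R : realType) (n : nat).
Implicit Types (v w : 'rV[R]_n.+1 -> R) (z u : 'rV[R]_n.+1).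

(** The first and second derivatives are carried along with their continuity, which
    differentiation under the integral sign needs. *)
Definition C2_harmonic (b : R) w := exists w1 w2 : 'I_n.+1 -> 'rV[R]_n.+1 -> R,
  [/\ cont_strip b w, forall i, cont_strip b (w1 i), forall i, cont_strip b (w2 i) &
  forall u, - b < u 0 ord0 < b ->
   [/\ forall i, is_derive (0 : R) 1 (fun s => w (line u i s)) (w1 i u),
       forall i, is_derive (0 : R) 1 (fun s => w1 i (line u i s)) (w2 i u) &
       \sum_i w2 i u = 0]].

Definition half_primitive (b : R) w z : R :=
  2^-1 * (primitive b w z (z 0 ord0) - primitive b w z 0).

Lemma near_strip (b t : R) : - b < t < b -> \forall s \near (0 : R), - b < t + s < b.
Proof.
move=> /andP[t1 t2].
have c : t + s @[s --> (0 : R)] --> t.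
  by rewrite -{2}(addr0 t); exact: (cvgD (cvg_cst t) cvg_id).
apply: (c (fun s => - b < s < b)).
have : t \in `]- b, b[ by rewrite in_itv /= t1.
by move=> /near_in_itvoo; apply: filterS => s; rewrite in_itv.
Qed.

Lemma primitive_line0 b w z s t :
  primitive b w (line z ord0 s) t = primitive b w z t.
Proof. by apply: eq_Rintegral => u _; rewrite put_line0. Qed.

Lemma half_primitive0 b w z : z 0 ord0 = 0 -> half_primitive b w z = 0.
Proof. by rewrite /half_primitive => ->; rewrite subrr mulr0. Qed.

Lemma is_derive_half_primitive b b' w z t : 0 < b -> b < b' -> cont_strip b' w ->
  - b < z 0 ord0 + t < b ->
  is_derive t 1 (fun s => half_primitive b w (line z ord0 s))
    (2^-1 * w (line z ord0 t)).
Proof.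
move=> b0 bb cw zt.
rewrite (_ : (fun s => _) = fun s =>
    2^-1 * (primitive b w z (z 0 ord0 + 1 * s) - primitive b w z 0)); last first.
  by apply/funext => s; rewrite /half_primitive !primitive_line0 line_diag mul1r.
apply: is_deriveZ; rewrite -[X in is_derive _ _ _ X]subr0; apply: is_deriveB.
have dp : is_derive (z 0 ord0 + 1 * t) 1 (primitive b w z) (w (put z (z 0 ord0 + 1 * t))).
  by apply: (is_derive_primitive b0 bb z cw); rewrite mul1r.
apply: (@is_derive_chain R (primitive b w z) (fun s => z 0 ord0 + 1 * s) t _ _ _ dp
  (is_derive_affine _ _ _)).
by rewrite !mul1r -line_put put_id.
Qed.

(** [half_primitive b w] is harmonic because [w] is: its Laplacian is half of
    [w_t (t) - \int_0^t w_tt = w_t (0)], which is [0] by evenness; and the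
    Laplacian of [t * half_primitive b w] is twice its [t]-derivative. *)
Lemma lap_half_primitive b b' w z : 0 < b -> b < b' -> C2_harmonic b' w ->
  (forall z t, w (put z (- t)) = w (put z t)) -> - b < z 0 ord0 < b ->
  lap (half_primitive b w) z 0 /\
  lap (fun z => z 0 ord0 * half_primitive b w z) z (w z).
Proof.
move=> b0 bb [w1 [w2 [cw cw1 cw2 dw]]] we zb.
have zb' u : - b < u 0 ord0 < b -> - b' < u 0 ord0 < b'.
  by move=> /andP[? ?]; apply/andP; split; lra.
pose J i t := primitive b (w2 i) z t - primitive b (w2 i) z 0.
pose l i := 2^-1 * (if i == ord0 then w1 ord0 z else J i (z 0 ord0)).
have dz s : - b < z 0 ord0 + s < b ->
    is_derive s 1 (fun s => half_primitive b w (line z ord0 s)) (2^-1 * w (line z ord0 s)).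
  exact: (is_derive_half_primitive b0 bb cw).
have dz2 : is_derive (0 : R) 1 (fun s => 2^-1 * w (line z ord0 s)) (2^-1 * w1 ord0 z).
  by apply: is_deriveZ; have [d1 _ _] := dw z (zb' z zb); exact: d1.
have d0 : sder (fun s => half_primitive b w (line z ord0 s)) 0 (l ord0).
  exists (fun s => 2^-1 * w (line z ord0 s)); split; last by rewrite /l eqxx.
  by have := near_strip zb; apply: filterS => s; exact: dz.
have di i : i != ord0 -> sder (fun s => half_primitive b w (line z i s)) 0 (l i).
  move=> i0.
  have E phi : (fun s => half_primitive b phi (line z i s)) = fun s => 2^-1 *
      (primitive b phi (line z i s) (z 0 ord0) - primitive b phi (line z i s) 0).
    by apply/funext => s; rewrite /half_primitive line_off.
  have D phi phi1 (t : R) : cont_strip b' phi -> cont_strip b' phi1 ->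
      (forall u : 'rV[R]_n.+1, - b' < u 0 ord0 < b' ->
        is_derive (0 : R) 1 (fun s => phi (line u i s)) (phi1 u)) ->
      is_derive t 1 (fun s => half_primitive b phi (line z i s))
        (half_primitive b phi1 (line z i t)).
    move=> c1 c2 d; rewrite E /half_primitive line_off//.
    apply: is_deriveZ; apply: is_deriveB;
      apply: (is_derive_primitive_lateral b0 bb z i0 c1 c2 d).
      by move: zb => /andP[-> /ltW].
    by apply/andP; split; lra.
  exists (fun s => half_primitive b (w1 i) (line z i s)); split.
    by apply: filterE => t; apply: D => // u ub; have [h _ _] := dw u ub.
  have -> : l i = half_primitive b (w2 i) (line z i 0).
    by rewrite /l (negPf i0) line0.
  by apply: D => // u ub; have [_ h _] := dw u ub.
have suml : \sum_i l i = 0.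
  rewrite -mulr_sumr (bigD1 ord0)//=.
  rewrite (eq_bigr (fun i => J i (z 0 ord0))); last by move=> i /negPf->.
  (* Twice the Laplacian of [half_primitive b w] at height [t]; its derivative in
     [t] is the Laplacian of [w], so it keeps the value that it has at height 0. *)
  pose psi t := w1 ord0 (put z t) + \sum_(i | i != ord0) J i t.
  have dpsi t : - b < t < b -> is_derive t 1 psi 0.
    move=> tb; have tb' : - b' < put z t 0 ord0 < b' by apply: zb'; rewrite put_diag.
    have [_ d2 s2] := dw _ tb'.
    rewrite -s2 (bigD1 ord0)//=; apply: is_deriveD.
      have := @is_derive_line R n.+1 (w1 ord0) (put z 0) ord0 t (w2 ord0 (put z t)).
      rewrite line_put add0r => /(_ (d2 ord0)).
      by under [X in is_derive _ _ X]eq_fun do rewrite line_put add0r.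
    apply: is_derive_bigsum => i i0; rewrite -[X in is_derive _ _ _ X]subr0.
    by apply: is_deriveB; exact: (is_derive_primitive b0 bb z (cw2 i) tb).
  have : psi (z 0 ord0) = psi 0.
    apply: (is_derive_const_itv dpsi) => //; apply/andP; split; lra.
  rewrite /psi put_id => ->; rewrite big1 ?addr0 => [|i _]; last by rewrite /J subrr.
  have b00 : - b' < put z 0 0 ord0 < b' by rewrite put_diag; apply/andP; split; lra.
  have [d1 _ _] := dw _ b00.
  rewrite (is_derive_even _ (d1 ord0)) ?mulr0// => s.
  by rewrite !line_put !add0r we.
split; first by exists l; split=> // i; have [->//|] := eqVneq i ord0; exact: di.
exists (fun i => z 0 ord0 * l i + (if i == ord0 then w z else 0)); split; last first.
  by rewrite big_split /= -mulr_sumr suml mulr0 add0r -big_mkcond big_pred1_eq.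
move=> i; have [->|i0] := eqVneq i ord0; last first.
  rewrite addr0; under [X in sder X]eq_fun do rewrite line_off//.
  by apply: sderZ; exact: di.
under [X in sder X]eq_fun do rewrite line_diag.
have da (s : R) : is_derive s 1 (fun s => z 0 ord0 + s) 1.
  by rewrite -[X in is_derive _ _ _ X]add0r; apply: is_deriveD.
exists (fun s => half_primitive b w (line z ord0 s) +
  (z 0 ord0 + s) * (2^-1 * w (line z ord0 s))); split.
  have := near_strip zb; apply: filterS => s sb.
  have := is_deriveM (da s) (dz s sb).
  by rewrite /GRing.scale /= mulr1 addrC.
have zb0 : - b < z 0 ord0 + 0 < b by rewrite addr0.
have := is_deriveD (dz 0 zb0) (is_deriveM (da 0) dz2).
rewrite (_ : _ + _ = z 0 ord0 * l ord0 + w z)//.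
by rewrite /GRing.scale /= line0 /l eqxx addr0; field.
Qed.

End Almansi.

Section AlmansiRepresentation.
Variables (R : realType) (n : nat).
Implicit Types (f g v w : 'rV[R]_n.+1 -> R) (z u : 'rV[R]_n.+1).

Lemma near_coord z i (a : set R) : nbhs (z 0 i) a ->
  \forall y \near z, a ((y : 'rV[R]_n.+1) 0 i).
Proof. exact: (@cont_coord R n.+1 z i a). Qed.

Lemma harm_near f g z : (\forall y \near z, f y = g y) -> harm f z -> harm g z.
Proof.
move=> E [cf lf]; split; last exact: lap_near E lf.
apply/contP => e e0; have /contP/(_ e e0) := cf.
have F : Filter (nbhs z) := nbhs_filter z.
have fz := nbhs_singleton E.
by apply: filterS2 E => y <-; rewrite fz.
Qed.

Lemma harm_half_primitive b b' w z : 0 < b -> b < b' -> C2_harmonic b' w ->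
  (forall z t, w (put z (- t)) = w (put z t)) -> - b < z 0 ord0 < b ->
  harm (half_primitive b w) z.
Proof.
move=> b0 bb hw we zb; split; last by have [] := lap_half_primitive b0 bb hw we zb.
have [_ [_ [cw _ _ _]]] := hw.
apply: contM; first exact: cont_cst.
apply: contB; first exact: (cont_primitive_diag b0 bb cw zb).
by apply: (cont_primitive b0 bb) => //; apply/andP; split; lra.
Qed.

(** Both [v] and [z_0 * half_primitive b w] have Laplacian [w]; their difference
    is harmonic with zero Cauchy data on the hyperplane, so it continues by zero
    to a harmonic function, which vanishes by unique continuation. *)
Lemma almansi b b' v w : 0 < b -> b < b' -> C2_harmonic b' w ->
  (forall z t, w (put z (- t)) = w (put z t)) ->
  (forall z t, v (put z (- t)) = v (put z t)) ->
  (forall z, - b' < z 0 ord0 < b' -> cont v z /\ lap v z (w z)) ->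
  (forall z, z 0 ord0 = 0 -> v z = 0) ->
  forall z, 0 <= z 0 ord0 < b -> v z = z 0 ord0 * half_primitive b w z.
Proof.
move=> b0 bb hw we ve hv v0.
pose H := half_primitive b w.
pose g z := v z - z 0 ord0 * H z.
have hH z : - b < z 0 ord0 < b -> harm H z by exact: harm_half_primitive hw we.
have hg z : - b < z 0 ord0 < b -> harm g z.
  move=> zb; have [|cv lv] := hv z; first by apply/andP; split; lra.
  have [cH _] := hH z zb; have [_ lH] := lap_half_primitive b0 bb hw we zb.
  split; first by apply: contB => //; apply: contM => //; exact: cont_coord.
  by rewrite -(subrr (w z)); exact: lapB.
have g0 z : z 0 ord0 = 0 -> g z = 0.
  by move=> z0; rewrite /g v0// z0 mul0r subr0.
(* Across [t = 0] all pure second derivatives of the glued function vanish. *)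
pose G z := if 0 < z 0 ord0 then g z else 0.
have hG z : - b < z 0 ord0 < b -> harm G z.
  move=> zb; case: (ltgtP 0 (z 0 ord0)) => z0.
  - apply: harm_near (hg z zb); have := near_coord (lt_nbhsr z0).
    by apply: filterS => y /=; rewrite /G => ->.
  - have F : Filter (nbhs z) := nbhs_filter z.
    apply: (@harm_near (fun=> 0)); last by split; [exact: cont_cst|exact: lap_cst].
    have := near_coord (lt_nbhsl z0).
    by apply: filterS => y /= y0; rewrite /G ltNge ltW.
  have [cg [l [gl suml]]] := hg z zb.
  split.
    apply/contP => e e0; have /contP/(_ e e0) := cg.
    have F : Filter (nbhs z) := nbhs_filter z.
    apply: filterS => y; rewrite g0// /G -z0 ltxx.
    by case: ifP => // _ _; rewrite subrr normr0 ltW.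
  have off i : i != ord0 -> (fun s => g (line z i s)) = fun=> 0.
    by move=> i0; apply/funext => s; rewrite g0// line_off.
  have li i : i != ord0 -> l i = 0.
    by move=> i0; apply: sder_uniq (gl i) _; rewrite off//; exact: sder_cst.
  (* The lateral second derivatives vanish, hence so does the one in [t]. *)
  have l0 : l ord0 = 0.
    by move: suml; rewrite (bigD1 ord0)//= big1 ?addr0// => i /li.
  exists (fun=> 0); rewrite big1//; split => // i.
  have [->|i0] := eqVneq i ord0; last first.
    rewrite (_ : (fun s => _) = fun=> 0); first exact: sder_cst.
    by apply/funext => s; rewrite /G line_off// -z0 ltxx.
  rewrite (_ : (fun s => G _) = fun s => if 0 < s then g (line z ord0 s) else 0).
    apply: sder_cutoff; first by rewrite line0 g0.
      have [|_ [lv [vl _]]] := hv z; first by apply/andP; split; lra.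
      have [dv [dv1 _]] := vl ord0.
      have d1 := nbhs_singleton dv1.
      have E s : line z ord0 s = put z s by rewrite /put -z0 subr0.
      have dv0 : dv 0 = 0 by apply: is_derive_even d1 => s; rewrite !E ve.
      rewrite dv0 in d1.
      have [_ [_ [cw _ _ _]]] := hw.
      have z00 : - b < z 0 ord0 + 0 < b by rewrite addr0.
      have d2 := is_derive_half_primitive b0 bb cw z00.
      have d3 := is_deriveB d1 (is_deriveM (is_derive_id (0 : R) 1) d2).
      rewrite (_ : (fun s => g _) = fun s => v (line z ord0 s) - s * H (line z ord0 s)).
        move: d3; rewrite (_ : 0 - _ = 0 :> R)//.
        by rewrite /GRing.scale /= line0 (half_primitive0 b w (esym z0)) !mul0r addr0 subr0.
      by apply/funext => s; rewrite /g line_diag -z0 add0r.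
    by have := gl ord0; rewrite l0.
  by apply/funext => s; rewrite /G line_diag -z0 add0r.
have G0 z : - b < z 0 ord0 < b -> G z = 0.
  apply: (@unique_continuation _ _ G (- b) b 0) => //; first by rewrite oppr_lt0.
  by move=> u /andP[_ u0]; rewrite /G ltNge u0.
move=> z /andP[z0 zb]; move: z0; rewrite le_eqVlt => /orP[/eqP z0|z0].
  by rewrite -z0 mul0r v0.
have zb' : - b < z 0 ord0 < b by apply/andP; split; lra.
by have /eqP := G0 z zb'; rewrite /G z0 subr_eq0 => /eqP.
Qed.

End AlmansiRepresentation.

(** * Removing the factor 1/t *)
Section PoissonBarrier.
Variables (R : realType) (n : nat).
Implicit Types (f H v : 'rV[R]_n.+1 -> R) (x z : 'rV[R]_n.+1).

(** The Poisson kernel of the half plane [T > 0], up to the factor [pi]; on the line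
    [Z = 0] it equals [1/T]. *)
Definition poisson (T Z : R) : R := T / (T ^+ 2 + Z ^+ 2).

Lemma sder_poisson_height (T Z : R) : 0 < T -> sder (poisson ^~ Z) T
  (2 * T * (T ^+ 2 - 3 * Z ^+ 2) / (T ^+ 2 + Z ^+ 2) ^+ 3).
Proof.
move=> T0.
have den (t : R) : 0 < t -> t ^+ 2 + Z ^+ 2 != 0.
  by move=> t0; rewrite gt_eqF// ltr_wpDr ?sqr_ge0// exprn_gt0.
have dd (t : R) : is_derive t 1 (fun t => t ^+ 2 + Z ^+ 2) (2 * t).
  rewrite -[2 * t](_ : 0 + 2 * 1 * t = _); last by ring.
  by apply: (@is_derive_quadratic _ _ (Z ^+ 2)) => u; ring.
exists (fun t => (Z ^+ 2 - t ^+ 2) / (t ^+ 2 + Z ^+ 2) ^+ 2); split.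
  have := lt_nbhsr T0; apply: filterS => t /= t0.
  apply: (is_derive_eq (@is_derive_frac _ (fun t => t) _ t _ _ (den t t0) (is_derive_id t 1) (dd t))).
  by congr (_ / _); ring.
have dn : is_derive T 1 (fun t => Z ^+ 2 - t ^+ 2) (- 2 * T).
  rewrite -[- 2 * T](_ : 0 + 2 * (- 1) * T = _); last by ring.
  by apply: (@is_derive_quadratic _ _ (Z ^+ 2)) => u; ring.
have d2 : is_derive T 1 (fun t => (t ^+ 2 + Z ^+ 2) ^+ 2)
    (4 * T * (T ^+ 2 + Z ^+ 2)).
  have -> : (fun t => (t ^+ 2 + Z ^+ 2) ^+ 2) =
      (fun t => t ^+ 2 + Z ^+ 2) * (fun t => t ^+ 2 + Z ^+ 2).
    by apply/funext => t; rewrite expr2.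
  apply: (is_derive_eq (is_deriveM (dd T) (dd T))).
  by rewrite /GRing.scale /=; ring.
apply: (is_derive_eq (@is_derive_frac _ (fun t => Z ^+ 2 - t ^+ 2)
  (fun t => (t ^+ 2 + Z ^+ 2) ^+ 2) T _ _ (expf_neq0 2 (den T T0)) dn d2)).
by field; exact: den.
Qed.

Lemma sder_poisson_width (T Z : R) : 0 < T -> sder (poisson T) Z
  (- (2 * T * (T ^+ 2 - 3 * Z ^+ 2) / (T ^+ 2 + Z ^+ 2) ^+ 3)).
Proof.
move=> T0.
have den (t : R) : T ^+ 2 + t ^+ 2 != 0.
  by rewrite gt_eqF// ltr_wpDr ?sqr_ge0// exprn_gt0.
have dd (t : R) : is_derive t 1 (fun t => T ^+ 2 + t ^+ 2) (2 * t).
  rewrite -[2 * t](_ : 0 + 2 * 1 * t = _); last by ring.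
  by apply: (@is_derive_quadratic _ _ (T ^+ 2)) => u; ring.
apply: (@sder_everywhere _ _ (fun t => - 2 * T * t / (T ^+ 2 + t ^+ 2) ^+ 2)).
  move=> t; apply: (is_derive_eq (@is_derive_frac _ (fun=> T) _ t _ _ (den t) (is_derive_cst T t 1) (dd t))).
  by congr (_ / _); rewrite /=; ring.
have dn : is_derive Z 1 (fun t => - 2 * T * t) (- 2 * T).
  have := is_derive_affine 0 (- 2 * T) Z.
  by under eq_fun do rewrite add0r.
have d2 : is_derive Z 1 (fun t => (T ^+ 2 + t ^+ 2) ^+ 2)
    (4 * Z * (T ^+ 2 + Z ^+ 2)).
  have -> : (fun t => (T ^+ 2 + t ^+ 2) ^+ 2) =
      (fun t => T ^+ 2 + t ^+ 2) * (fun t => T ^+ 2 + t ^+ 2).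
    by apply/funext => t; rewrite expr2.
  apply: (is_derive_eq (is_deriveM (dd Z) (dd Z))).
  by rewrite /GRing.scale /=; ring.
apply: (is_derive_eq (@is_derive_frac _ (fun t => - 2 * T * t)
  (fun t => (T ^+ 2 + t ^+ 2) ^+ 2) Z _ _ (expf_neq0 2 (den Z)) dn d2)).
by field; exact: den.
Qed.

Lemma poisson_ge0 (T Z : R) : 0 <= T -> 0 <= poisson T Z.
Proof. by move=> T0; rewrite divr_ge0// addr_ge0// sqr_ge0. Qed.

Lemma harm_poisson (delta a : R) (i : 'I_n.+1) z : i != ord0 ->
  0 < delta + z 0 ord0 ->
  harm (fun z => poisson (delta + z 0 ord0) (z 0 i - a)) z.
Proof.
move=> i0 z0; split.
  have cT : cont (fun z : 'rV[R]_n.+1 => delta + z 0 ord0) z.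
    by apply: contD; [exact: cont_cst|exact: cont_coord].
  have cZ : cont (fun z : 'rV[R]_n.+1 => z 0 i - a) z.
    by apply: contB; [exact: cont_coord|exact: cont_cst].
  apply: contM => //.
  apply: (@cont_comp _ _ (fun s : R => s^-1)); first by apply: contD; exact: cont_sqr.
  by apply: inv_continuous; rewrite gt_eqF// ltr_wpDr ?sqr_ge0// exprn_gt0.
have <- : 1 ^+ 2 * (2 * (delta + z 0 ord0) * ((delta + z 0 ord0) ^+ 2 -
     3 * (z 0 i - a) ^+ 2) / ((delta + z 0 ord0) ^+ 2 + (z 0 i - a) ^+ 2) ^+ 3) +
   1 ^+ 2 * (- (2 * (delta + z 0 ord0) * ((delta + z 0 ord0) ^+ 2 -
     3 * (z 0 i - a) ^+ 2) / ((delta + z 0 ord0) ^+ 2 + (z 0 i - a) ^+ 2) ^+ 3)) = 0.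
  by rewrite mulrN subrr.
apply: (@lap_coord2 _ _ ord0 i (fun s r => poisson (delta + s) (r - a))).
- by rewrite eq_sym.
- under eq_fun do rewrite -[X in _ + X]mul1r.
  apply: (@sder_comp_affine _ (poisson ^~ (z 0 i - a))).
  by rewrite mul1r; exact: sder_poisson_height.
- have -> : (fun r => poisson (delta + z 0 ord0) (r - a)) =
      fun r => poisson (delta + z 0 ord0) (- a + 1 * r).
    by apply/funext => r; rewrite mul1r (addrC r).
  apply: sder_comp_affine; rewrite mul1r (addrC (- a)).
  exact: sder_poisson_width.
Qed.

(** In each lateral direction, one kernel for each of the two faces at distance 1
    from [x]. *)
Definition poisson_barrier (delta : R) x z : R := \sum_(i | i != ord0)
  (poisson (delta + z 0 ord0) (z 0 i - (x 0 i + 1)) +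
   poisson (delta + z 0 ord0) (z 0 i - (x 0 i - 1))).

Lemma harm_poisson_barrier delta x z : 0 < delta + z 0 ord0 ->
  harm (poisson_barrier delta x) z.
Proof.
move=> z0; split.
  apply: cont_sum => i i0.
  by apply: contD; apply: (harm_poisson _ i0 z0).1.
have -> : 0 = \sum_(i < n.+1 | i != ord0) (0 + 0) :> R by rewrite big1// => *; rewrite addr0.
apply: lap_sum => i i0.
by apply: lapD; apply: (harm_poisson _ i0 z0).2.
Qed.

Lemma poisson_barrier_ge0 delta x z : 0 <= delta + z 0 ord0 ->
  0 <= poisson_barrier delta x z.
Proof.
by move=> z0; apply: sumr_ge0 => i _; rewrite addr_ge0// poisson_ge0.
Qed.

Lemma poisson_barrier_face delta x z i : i != ord0 -> 0 < delta + z 0 ord0 ->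
  z 0 i = x 0 i - 1 \/ z 0 i = x 0 i + 1 ->
  (delta + z 0 ord0)^-1 <= poisson_barrier delta x z.
Proof.
move=> i0 z0 zi; rewrite /poisson_barrier (bigD1 i)//=.
have E : poisson (delta + z 0 ord0) 0 = (delta + z 0 ord0)^-1.
  by rewrite /poisson expr0n addr0; field; rewrite gt_eqF.
rewrite -[leLHS]addr0; apply: lerD; last first.
  by apply: sumr_ge0 => j _; rewrite addr_ge0// poisson_ge0// ltW.
case: zi => ->; rewrite subrr E.
  by rewrite lerDr poisson_ge0// ltW.
by rewrite lerDl poisson_ge0// ltW.
Qed.

Lemma poisson_barrier_center delta x t :  0 <= delta + (x 0 ord0 + t) ->
  poisson_barrier delta x (line x ord0 t) <= n%:R.
Proof.
move=> t0; rewrite -[leRHS]mulr1 -sum_lateral_cst; apply: ler_sum => i i0.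
rewrite line_diag line_off 1?eq_sym//.
rewrite (_ : x 0 i - (x 0 i + 1) = - 1); last by ring.
rewrite (_ : x 0 i - (x 0 i - 1) = 1); last by ring.
set T := delta + _ in t0 *.
rewrite /poisson sqrrN expr1n -mulrDl ler_pdivrMr; last first.
  by rewrite ltr_wpDl// sqr_ge0.
have := sqr_ge0 (T - 1); nra.
Qed.

(** [v = t * H] only gives [H <= M / t]; the Poisson kernels with poles at the
    corners of the box majorise [M / t] on its lateral faces and stay bounded
    above the centre of its base. The shift [delta] moves the poles out of the
    box; as [H] is bounded, twice the shifted barrier still dominates it for
    small [delta]. *)
Lemma quotient_bound_half H x (c M : R) : 0 < c -> 0 < M -> x 0 ord0 = 0 ->
  (forall z, 0 <= z 0 ord0 <= c -> (forall i, i != ord0 -> `|z 0 i - x 0 i| <= 1) ->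
     [/\ harm H z, z 0 ord0 * H z <= M & z 0 ord0 = 0 \/ z 0 ord0 = c -> H z = 0]) ->
  forall t, 0 <= t <= c -> H (line x ord0 t) <= 2 * n%:R * M.
Proof.
move=> c0 M0 x0 hH t /andP[t0 tc].
pose lo : 'rV[R]_n.+1 := \row_j if j == ord0 then 0 else x 0 j - 1.
pose hi : 'rV[R]_n.+1 := \row_j if j == ord0 then c else x 0 j + 1.
have boxP z : box lo hi z -> 0 <= z 0 ord0 <= c /\
    forall i, i != ord0 -> `|z 0 i - x 0 i| <= 1.
  move=> bz; split; first by have := bz ord0; rewrite !mxE eqxx.
  move=> i i0; have := bz i; rewrite !mxE (negPf i0) ler_norml.
  by move=> /andP[? ?]; apply/andP; split; lra.
have bt : box lo hi (line x ord0 t).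
  move=> i; have [->|i0] := eqVneq i ord0.
    by rewrite line_diag [lo _ _]mxE [hi _ _]mxE eqxx x0 add0r t0.
  rewrite line_off 1?eq_sym// [lo _ _]mxE [hi _ _]mxE (negPf i0).
  by apply/andP; split; lra.
have [K hK] : exists K, forall z, box lo hi z -> `|H z| <= K.
  by apply: box_bounded => z /boxP[b1 b2]; have [[]] := hH z b1 b2.
pose delta := M / (`|K| + 1).
have K1 : 0 < `|K| + 1 by rewrite ltr_wpDl.
have d0 : 0 < delta by rewrite divr_gt0.
have dK : K * delta <= M.
  rewrite /delta mulrA ler_pdivrMr// mulrC ler_pM2l//.
  by apply: le_trans (ler_norm _) _; rewrite lerDl.
have key : 0 <= 2 * M * poisson_barrier delta x (line x ord0 t) - H (line x ord0 t).
  apply: (@comparison _ _ lo hi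
    (fun z => 2 * M * poisson_barrier delta x z - H z)) bt.
  - move=> z /boxP[b1 b2]; have [[cH _] _ _] := hH z b1 b2.
    apply: contB => //; apply: contM; first exact: cont_cst.
    by have [] := @harm_poisson_barrier delta x z; first by move: b1 => /andP[? _]; lra.
  - move=> z bz; exists 0 => //.
    have [b1 b2] : 0 <= z 0 ord0 <= c /\ forall i, i != ord0 -> `|z 0 i - x 0 i| <= 1.
      by apply: boxP => i; have /andP[/ltW-> /ltW->] := bz i.
    have [[_ lH] _ _] := hH z b1 b2.
    have [|_ lB] := @harm_poisson_barrier delta x z.
      by move: b1 => /andP[? _]; lra.
    by rewrite -(subr0 0); apply: lapB lH; rewrite -(mulr0 (2 * M)); exact: lapZ.
  - move=> z i bz zi; have [b1 b2] := boxP _ bz.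
    have [_ zM H0] := hH z b1 b2; move: b1 => /andP[z0 zc].
    have zd : 0 < delta + z 0 ord0 by lra.
    have Bge : 0 <= poisson_barrier delta x z by rewrite poisson_barrier_ge0// ltW.
    have [i0|i0] := eqVneq i ord0.
      move: zi; rewrite i0 !mxE eqxx => /H0 ->; rewrite subr0.
      by rewrite mulr_ge0// mulr_ge0// ltW.
    have zi' : z 0 i = x 0 i - 1 \/ z 0 i = x 0 i + 1.
      by move: zi; rewrite !mxE (negPf i0).
    have := poisson_barrier_face i0 zd zi'.
    set B := poisson_barrier _ _ _ in Bge *.
    rewrite -(ler_pM2r zd) mulVf ?gt_eqF// => B1.
    have Kz := le_trans (ler_norm _) (hK z bz).
    rewrite subr_ge0 -(ler_pM2r zd).
    (* Below height [delta] the bound [K] on [H] suffices, above it [M / t]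
       does. *)
    have [zdel|delz] := leP (z 0 ord0) delta.
      have [Hn|Hp] := leP (H z) 0; first by nra.
      have : H z * delta <= M by nra.
      by nra.
    have [Hn|Hp] := leP (H z) 0; first by nra.
    by nra.
rewrite -subr_ge0; apply: le_trans key _; rewrite lerD2r.
rewrite [leRHS]mulrAC ler_wpM2l//; first by lra.
by apply: poisson_barrier_center; rewrite x0; lra.
Qed.

Lemma quotient_bound H x (c M : R) : 0 < c -> 0 < M -> x 0 ord0 = 0 ->
  (forall z, 0 <= z 0 ord0 <= c -> (forall i, i != ord0 -> `|z 0 i - x 0 i| <= 1) ->
     [/\ harm H z, `|z 0 ord0 * H z| <= M & z 0 ord0 = 0 \/ z 0 ord0 = c -> H z = 0]) ->
  forall t, 0 <= t <= c -> `|H (line x ord0 t)| <= 2 * n%:R * M.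
Proof.
move=> c0 M0 x0 hH t tc; rewrite ler_norml lerNl; apply/andP; split.
  apply: (@quotient_bound_half (fun z => - H z) x c) => // z z1 z2.
  have [h1 h2 h3] := hH z z1 z2; split; first exact: harmN.
    by rewrite mulrN; apply: le_trans h2; rewrite -normrN ler_norm.
  by move=> /h3 ->; rewrite oppr0.
apply: (@quotient_bound_half H x c) => // z z1 z2.
have [h1 h2 h3] := hH z z1 z2; split=> //.
exact: le_trans (ler_norm _) h2.
Qed.

Definition edge_constant (c : R) : R := 2 * n%:R * (n%:R * c + c^-1).

(** By [quotient_bound], [H] is bounded on a box; [linear_vanishing] at the bottom
    and, after the reflection [t -> c - t], at the top gives the decay at both. *)
Lemma quotient_edge_bound H x (c M : R) : 0 < c -> 0 < M -> x 0 ord0 = 0 ->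
  (forall z, 0 <= z 0 ord0 <= c -> (forall i, i != ord0 -> `|z 0 i - x 0 i| <= 2) ->
     [/\ harm H z, `|z 0 ord0 * H z| <= M & z 0 ord0 = 0 \/ z 0 ord0 = c -> H z = 0]) ->
  forall t, 0 <= t <= c ->
  `|H (line x ord0 t)| <= edge_constant c * M * Num.min t (c - t).
Proof.
move=> c0 M0 x0 hH t tc.
have E : edge_constant c * M = 2 * n%:R * M * (n%:R * c / 1 ^+ 2 + c^-1).
  by rewrite /edge_constant expr1n divr1; ring.
have bnd z : 0 <= z 0 ord0 <= c -> (forall i, i != ord0 -> `|z 0 i - x 0 i| <= 1) ->
    `|H z| <= 2 * n%:R * M.
  move=> zc zx; rewrite -(put_id z) -(add0r (z 0 ord0)) -line_put.
  apply: (@quotient_bound H (put z 0) c M) => //; first exact: put_diag.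
  move=> u uc uz; apply: hH => // i i0; have := uz i i0; have := zx i i0.
  rewrite put_off// !ler_norml => /andP[? ?] /andP[? ?].
  by apply/andP; split; lra.
have small z : 0 <= z 0 ord0 <= c -> (forall i, i != ord0 -> `|z 0 i - x 0 i| <= 1) ->
    [/\ harm H z, `|H z| <= 2 * n%:R * M & z 0 ord0 = 0 \/ z 0 ord0 = c -> H z = 0].
  move=> zc zx; have [|h1 h2 h3] := hH z zc.
    by move=> i i0; apply: le_trans (zx i i0) _; lra.
  by split=> //; exact: bnd.
move: (tc) => /andP[t0 t1].
rewrite minEle; case: ifP => _; rewrite E.
  apply: (@linear_vanishing _ _ H x 1 c) => // z; rewrite x0 add0r => zc zx.
  by have [h1 h2 h3] := small z zc zx; split => // z0; apply: h3; left.
pose fl := @flip R n.+1 ord0 c (-1).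
have flz z : fl z 0 ord0 = c - z 0 ord0 by rewrite flip_diag mulN1r.
have -> : line x ord0 t = fl (line x ord0 (c - t)).
  by rewrite /fl /flip line_diag line_line x0; congr line; ring.
apply: (@linear_vanishing _ _ (fun z => H (fl z)) x 1 c) => //; last first.
  by apply/andP; split; lra.
move=> z; rewrite x0 add0r => /andP[z0 zc] zx.
have [||h1 h2 h3] := small (fl z).
- by rewrite flz; apply/andP; split; lra.
- by move=> i i0; rewrite flip_off 1?eq_sym//; exact: zx.
split=> //; first by apply: harm_flip => //; rewrite sqrrN expr1n.
by move=> z00; apply: h3; right; rewrite flz z00 subr0.
Qed.

End PoissonBarrier.

(** * The superharmonic comparison function *)
Section SineLowerBound.
Variable R : realType.

(** On [[0, 1]] by the mean value theorem, with slope at least [cos 1]; beyond 1 by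
    monotonicity, losing a factor 2 because [pi / 2 < 2]. *)
Lemma sin_ge_linear (x : R) : 0 <= x <= pi / 2 -> cos 1 / 2 * x <= sin x.
Proof.
move=> /andP[x0 xp].
have c1 : 0 < cos 1 :> R := cos1_gt0 R.
have p2 : pi / 2 < 2 :> R := pihalf_lt2 R.
have p1 : 1 <= pi / 2 :> R := pihalf_ge1 R.
have small (y : R) : 0 < y -> y <= 1 -> cos 1 * y <= sin y.
  move=> y0 y1.
  have [|z] := @MVT R sin cos 0 y y0 (fun z _ => is_derive_sin z).
    by apply: continuous_subspaceT; exact: continuous_sin.
  rewrite in_itv /= => /andP[z0 zy]; rewrite sin0 !subr0 => ->.
  rewrite ler_wpM2r ?(ltW y0)// leNgt ltr_cos ?in_itv /=; first lra.
    by apply/andP; split; lra.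
  by apply/andP; split; lra.
have [->|xn0] := eqVneq x 0; first by rewrite mulr0 sin0.
have xp0 : 0 < x by rewrite lt_neqAle eq_sym xn0.
have [x1|x1] := leP x 1; first by have := small x xp0 x1; nra.
have : sin 1 < sin x.
  by rewrite ltr_sin// in_itv /=; apply/andP; split; lra.
have := small 1 ltr01 (lexx _); nra.
Qed.

Lemma min_le_sin (c t : R) : 0 < c -> 0 <= t <= c ->
  cos 1 / 2 * (pi / c) * Num.min t (c - t) <= sin (pi / c * t).
Proof.
move=> c0 /andP[t0 tc].
have p0 : 0 < pi :> R := pi_gt0 R.
have half s : s <= c / 2 -> pi / c * s <= pi / 2.
  move=> sc; have -> : pi / 2 = pi / c * (c / 2) by field; rewrite gt_eqF.
  by rewrite ler_wpM2l// divr_ge0 ?ltW.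
have pc : 0 <= pi / c by rewrite divr_ge0 ?ltW.
rewrite -mulrA minEle; case: ifP => h.
  by apply: sin_ge_linear; rewrite mulr_ge0//= half//; lra.
have -> : sin (pi / c * t) = sin (pi / c * (c - t)).
  rewrite (_ : pi / c * (c - t) = pi - pi / c * t); last by field; rewrite gt_eqF.
  by rewrite sinB sinpi cospi mul0r sub0r mulN1r opprK.
move: h => /negbT; rewrite -ltNge => h.
by apply: sin_ge_linear; rewrite mulr_ge0//= ?half//; lra.
Qed.

End SineLowerBound.

Section RadialBarrier.
Variables (R : realType) (n : nat).
Implicit Types (H : 'rV[R]_n.+1 -> R) (x z : 'rV[R]_n.+1).

Definition lateral_sq z : R := \sum_(i | i != ord0) z 0 i ^+ 2.

Lemma lateral_sq_ge0 z : 0 <= lateral_sq z.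
Proof. by apply: sumr_ge0 => i _; exact: sqr_ge0. Qed.

Lemma lateral_sq_line0 z s : lateral_sq (line z ord0 s) = lateral_sq z.
Proof. by apply: eq_bigr => i i0; rewrite line_off// eq_sym. Qed.

Lemma lateral_sq_line z i s : i != ord0 ->
  lateral_sq (line z i s) = lateral_sq z + 2 * z 0 i * s + s ^+ 2.
Proof.
move=> i0; rewrite /lateral_sq (bigD1 i)//= [in RHS](bigD1 i)//= line_diag.
rewrite (eq_bigr (fun j => z 0 j ^+ 2)); first by ring.
by move=> j /andP[_ ji]; rewrite line_off// eq_sym.
Qed.

Lemma cont_lateral_sq z : cont lateral_sq z.
Proof. by apply: cont_sum => i _; apply: cont_sqr; exact: cont_coord. Qed.

Variables (k m : R).
Hypotheses (k0 : 0 < k) (m0 : 0 <= m).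

(** As a function of [s = rho ^+ 2] this is [rho^-m * exp (k rho)], which has the
    growth of the regular radial solution of [Lap f = k^2 f] in dimension [2m+1]. *)
Definition radial (s : R) : R := expR (k * Num.sqrt s - m / 2 * ln s).

Definition radial_logder (s : R) : R := k / (2 * Num.sqrt s) - m / 2 / s.

Lemma radial_gt0 s : 0 < radial s.
Proof. exact: expR_gt0. Qed.

Lemma is_derive_radial (s : R) : 0 < s ->
  is_derive s 1 radial (radial_logder s * radial s).
Proof.
move=> s0.
have h1 := is_deriveZ k (is_derive1_sqrt s0).
have h2 := is_deriveZ (m / 2) (is_derive1_ln s0).
have h3 := is_deriveB h1 h2.
have h4 := is_derive_expR (k * Num.sqrt s - m / 2 * ln s).
apply: (@is_derive_chain R expR (fun s => k * Num.sqrt s - m / 2 * ln s) s _ _ _ h4 h3).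
by [].
Qed.

Lemma is_derive_radial_logder (s : R) : 0 < s -> is_derive s 1 radial_logder
  (- (k / (4 * s * Num.sqrt s)) + m / 2 / s ^+ 2).
Proof.
move=> s0.
have q0 : 0 < Num.sqrt s by rewrite sqrtr_gt0.
have qs : Num.sqrt s ^+ 2 = s by rewrite sqr_sqrtr// ltW.
have q20 : 2 * Num.sqrt s != 0 by rewrite mulf_neq0// gt_eqF.
have h1 : is_derive s 1 (fun t => 2 * Num.sqrt t) (2 * (2 * Num.sqrt s)^-1).
  exact: (is_deriveZ 2 (is_derive1_sqrt s0)).
have h2 := @is_derive_frac R (fun=> k) _ s _ _ q20 (is_derive_cst k s 1) h1.
have h3 := @is_derive_frac R (fun=> m / 2) (fun t => t) s _ _ (lt0r_neq0 s0)
  (is_derive_cst (m / 2) s 1) (is_derive_id s 1).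
apply: (is_derive_eq (is_deriveB h2 h3)).
rewrite /GRing.scale /=; move: q0 qs; set r := Num.sqrt s => r0 <-.
by field; rewrite gt_eqF.
Qed.

(** The second derivative of [radial]. *)
Definition radial_2nd (s : R) : R :=
  (- (k / (4 * s * Num.sqrt s)) + m / 2 / s ^+ 2 + radial_logder s ^+ 2) * radial s.

Lemma is_derive_radial2 (s : R) : 0 < s ->
  is_derive s 1 (fun t => radial_logder t * radial t) (radial_2nd s).
Proof.
move=> s0.
apply: (is_derive_eq (is_deriveM (is_derive_radial_logder s0) (is_derive_radial s0))).
by rewrite /radial_2nd /GRing.scale /=; ring.
Qed.

(** For [f = radial (a^2 + |y|^2)] in dimension [2m+1] the left side is [Lap f].
    In powers of [1/rho] the terms of orders 0 and 1 of [Lap f / f - k^2] cancel;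
    the shift contributes [- (k a)^2 / rho^2], which outweighs the rest on the whole
    space when [k a = 2m+2]. *)
Lemma radial_supersolution (a s : R) : 0 < a -> k * a = 2 * m + 2 ->
  a ^+ 2 <= s ->
  4 * (s - a ^+ 2) * radial_2nd s + 2 * (2 * m + 1) * (radial_logder s * radial s)
  <= k ^+ 2 * radial s.
Proof.
have K0 := k0; have M0 := m0; move=> a0 ka as_.
have s0 : 0 < s by apply: lt_le_trans as_; rewrite exprn_gt0.
pose r := Num.sqrt s.
have r0 : 0 < r by rewrite sqrtr_gt0.
have rs : s = r ^+ 2 by rewrite sqr_sqrtr// ltW.
have ar : a <= r.
  by rewrite /r -(ger0_norm (ltW a0)) -sqrtr_sqr ler_wsqrtr.
rewrite /radial_2nd !mulrA -mulrDl ler_pM2r ?radial_gt0//.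
rewrite /radial_logder -/r rs -subr_ge0.
have -> : k ^+ 2 - (4 * (r ^+ 2 - a ^+ 2) *
     (- (k / (4 * r ^+ 2 * r)) + m / 2 / (r ^+ 2) ^+ 2 +
      (k / (2 * r) - m / 2 / r ^+ 2) ^+ 2) +
     2 * (2 * m + 1) * (k / (2 * r) - m / 2 / r ^+ 2)) =
   ((m ^+ 2 - m + (k * a) ^+ 2) * r ^+ 2 - a * (k * a) * (1 + 2 * m) * r
     + a ^+ 2 * (m ^+ 2 + 2 * m)) / r ^+ 4.
  by field; rewrite gt_eqF.
rewrite divr_ge0 ?exprn_ge0 ?ltW// ka.
have h1 : a * r <= r ^+ 2 by rewrite expr2 ler_wpM2r// ltW.
have h2 : 0 <= a ^+ 2 * (m ^+ 2 + 2 * m).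
  by rewrite mulr_ge0 ?sqr_ge0// addr_ge0 ?sqr_ge0// mulr_ge0.
have h3 : 0 <= (2 * m + 2) * (1 + 2 * m) by rewrite mulr_ge0//; lra.
have h4 := ler_wpM2l h3 h1.
have h5 : 0 <= r ^+ 2 * (m ^+ 2 + m + 2).
  by rewrite mulr_ge0 ?sqr_ge0//; have := sqr_ge0 m; lra.
nra.
Qed.

Lemma sder_radial_line (s0 b : R) : (forall s : R, 0 < s0 + 2 * b * s + s ^+ 2) ->
  sder (fun s => radial (s0 + 2 * b * s + s ^+ 2)) 0
    (4 * b ^+ 2 * radial_2nd s0 + 2 * (radial_logder s0 * radial s0)).
Proof.
move=> pos.
have dq (s : R) : is_derive s 1 (fun s => s0 + 2 * b * s + s ^+ 2) (2 * b + 2 * s).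
  rewrite -[2 * b + _](_ : 2 * b + 2 * 1 * s = _); last by ring.
  by apply: (@is_derive_quadratic _ _ s0) => t; rewrite mul1r.
apply: (@sder_everywhere _ _ (fun s => (2 * b + 2 * s) *
  (radial_logder (s0 + 2 * b * s + s ^+ 2) * radial (s0 + 2 * b * s + s ^+ 2)))).
  move=> t; exact: (@is_derive_chain R radial (fun s => s0 + 2 * b * s + s ^+ 2)
    t _ _ _ (is_derive_radial (pos t)) (dq t)).
have e0 : s0 + 2 * b * 0 + 0 ^+ 2 = s0 by rewrite mulr0 expr0n !addr0.
have d2 := @is_derive_chain R (fun t => radial_logder t * radial t)
  (fun s => s0 + 2 * b * s + s ^+ 2) 0 _ _ _ (is_derive_radial2 (pos 0)) (dq 0) erefl.
apply: (is_derive_eq (is_deriveM (is_derive_affine (2 * b) 2 0) d2)).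
by rewrite /GRing.scale /= e0 !mulr0 !addr0; ring.
Qed.

Definition radial_barrier (a : R) z : R :=
  sin (k * z 0 ord0) * radial (a ^+ 2 + lateral_sq z).

Lemma cont_radial_barrier (a : R) z : 0 < a -> cont (radial_barrier a) z.
Proof.
move=> a0; apply: contM.
  apply: (@cont_comp _ _ sin); last exact: continuous_sin.
  by apply: contM; [exact: cont_cst|exact: cont_coord].
apply: (@cont_comp _ _ radial).
  by apply: contD; [exact: cont_cst|exact: cont_lateral_sq].
apply: differentiable_continuous; apply/derivable1_diffP.
apply: (@ex_derive _ _ _ _ _ _ _ (is_derive_radial _)).
by rewrite ltr_pwDl ?lateral_sq_ge0// exprn_gt0.
Qed.

(** The sine contributes [- k^2] and the radial factor at most [k^2]. *)
Lemma lap_radial_barrier (a : R) z : n%:R = 2 * m + 1 -> 0 < a ->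
  k * a = 2 * m + 2 -> 0 <= sin (k * z 0 ord0) ->
  exists2 L, L <= 0 & lap (radial_barrier a) z L.
Proof.
move=> nm a0 ka s0.
pose q := a ^+ 2 + lateral_sq z.
have a2 : 0 < a ^+ 2 by rewrite exprn_gt0.
pose P := radial_logder q * radial q.
pose l i := if i == ord0 then - k ^+ 2 * sin (k * z 0 ord0) * radial q
  else sin (k * z 0 ord0) * (4 * z 0 i ^+ 2 * radial_2nd q + 2 * P).
exists (\sum_i l i).
  have -> : \sum_i l i = sin (k * z 0 ord0) * ((4 * (q - a ^+ 2) * radial_2nd q +
      2 * (2 * m + 1) * P) - k ^+ 2 * radial q).
    rewrite (bigD1 ord0)//= {1}/l eqxx.
    rewrite (eq_bigr (fun i => sin (k * z 0 ord0) *
      (4 * radial_2nd q * z 0 i ^+ 2) + sin (k * z 0 ord0) * (2 * P))); last first.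
      by move=> i /negPf i0; rewrite /l i0; ring.
    rewrite big_split /= sum_lateral_cst -mulr_sumr -mulr_sumr -/(lateral_sq z) nm.
    by rewrite /q; ring.
  rewrite mulr_ge0_le0// subr_le0.
  by apply: radial_supersolution => //; rewrite /q lerDl lateral_sq_ge0.
exists l; split => // i; rewrite /l; have [->|i0] := eqVneq i ord0.
  rewrite (_ : (fun s => _) = fun s =>
      radial q * sin (k * z 0 ord0 + k * s)); last first.
    by apply/funext => s; rewrite /radial_barrier lateral_sq_line0 line_diag mulrC mulrDr.
  rewrite (_ : - k ^+ 2 * _ * _ = radial q * (k ^+ 2 * - sin (k * z 0 ord0 + k * 0))).
    apply: sderZ; apply: sder_comp_affine.
    by apply: (@sder_everywhere _ _ cos).
  by rewrite mulr0 addr0; ring.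
rewrite (_ : (fun s => _) = fun s => sin (k * z 0 ord0) *
    radial (q + 2 * z 0 i * s + s ^+ 2)); last first.
  apply/funext => s; rewrite /radial_barrier line_off// lateral_sq_line//.
  by rewrite /q !addrA.
apply: sderZ; apply: sder_radial_line => s.
have -> : q + 2 * z 0 i * s + s ^+ 2 = a ^+ 2 + lateral_sq (line z i s).
  by rewrite lateral_sq_line// /q; ring.
by rewrite ltr_pwDl ?lateral_sq_ge0.
Qed.

End RadialBarrier.

(** * A Liouville theorem in the strip *)
Section Liouville.
Variables (R : realType) (n : nat).
Implicit Types (H : 'rV[R]_n.+1 -> R) (x z : 'rV[R]_n.+1).

Lemma strip_liouville_half H (c a m : R) : 0 < c -> 0 < a -> 0 <= m ->
  n%:R = 2 * m + 1 -> pi / c * a = 2 * m + 2 ->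
  (forall z, 0 <= z 0 ord0 <= c -> harm H z) ->
  (forall z, z 0 ord0 = 0 \/ z 0 ord0 = c -> H z <= 0) ->
  (forall e : R, 0 < e -> exists L : R, forall z, 0 <= z 0 ord0 <= c ->
     L <= lateral_sq z -> H z <= e * radial_barrier (pi / c) m a z) ->
  forall z, 0 <= z 0 ord0 <= c -> H z <= 0.
Proof.
move=> c0 a0 m0 nm ka hH H0 gH x xc.
have p0 : 0 < pi :> R := pi_gt0 R.
have k0 : 0 < pi / c by rewrite divr_gt0.
set k := pi / c in ka gH k0.
pose W := radial_barrier (n := n) k m a.
have sin0c z : 0 <= z 0 ord0 <= c -> 0 <= sin (k * (z : 'rV[R]_n.+1) 0 ord0).
  move=> /andP[z0 zc]; apply: sin_ge0_pi; rewrite mulr_ge0 ?(ltW k0)//=.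
  have -> : pi = k * c by rewrite /k; field; rewrite gt_eqF.
  by rewrite ler_wpM2l// ltW.
have W0 z : 0 <= z 0 ord0 <= c -> 0 <= W z.
  by move=> zc; rewrite mulr_ge0 ?sin0c// ltW// radial_gt0.
suff HW e : 0 < e -> H x <= e * W x.
  rewrite leNgt; apply/negP => Hx.
  have Wx := W0 x xc.
  have := HW (H x / (W x + 1)); rewrite divr_gt0// ?ltr_wpDl// => /(_ isT).
  by apply/negP; rewrite -ltNge mulrAC ltr_pdivrMr ?ltr_wpDl//; nra.
move=> e0; have [L hL] := gH e e0.
(* The half width of a box that contains [x] and whose lateral faces lie in the
   region where the bound at infinity holds. *)
pose r := 1 + `|L| + \sum_i `|x 0 i|.
have sx : 0 <= \sum_i `|x 0 i| by apply: sumr_ge0.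
have r1 : 1 <= r by rewrite /r; have := normr_ge0 L; lra.
have rL : L <= r ^+ 2.
  have : L <= r by rewrite /r; have := ler_norm L; lra.
  by nra.
have xr i : `|x 0 i| <= r.
  rewrite /r (bigD1 i)//=; have := normr_ge0 L.
  have : 0 <= \sum_(j | j != i) `|x 0 j| by apply: sumr_ge0.
  by lra.
pose lo : 'rV[R]_n.+1 := \row_j if j == ord0 then 0 else - r.
pose hi : 'rV[R]_n.+1 := \row_j if j == ord0 then c else r.
have boxc z : box lo hi z -> 0 <= z 0 ord0 <= c.
  by move=> bz; have := bz ord0; rewrite !mxE eqxx.
rewrite -subr_ge0; apply: (@comparison _ _ lo hi (fun z => e * W z - H z)).
- move=> z /boxc zc; apply: contB; last by have [] := hH z zc.
  by apply: contM; [exact: cont_cst|exact: cont_radial_barrier].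
- move=> z bz.
  have zc : 0 <= z 0 ord0 <= c by apply: boxc => i; have /andP[/ltW-> /ltW->] := bz i.
  have [M M0 lM] := lap_radial_barrier k0 m0 nm a0 ka (sin0c z zc).
  exists (e * M - 0); first by rewrite subr0 mulr_ge0_le0// ltW.
  by apply: lapB; [exact: lapZ|have [] := hH z zc].
- move=> z i bz zi; have zc := boxc z bz; rewrite subr_ge0.
  have [i0|i0] := eqVneq i ord0.
    move: zi; rewrite i0 !mxE eqxx => zi.
    by apply: le_trans (H0 z zi) _; rewrite mulr_ge0 ?W0// ltW.
  apply: hL => //; apply: le_trans rL _.
  rewrite /lateral_sq (bigD1 i)//= -[leLHS]addr0; apply: lerD.
    by move: zi; rewrite !mxE (negPf i0) => -[->|->]; rewrite ?sqrrN.
  by apply: sumr_ge0 => j _; exact: sqr_ge0.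
- move=> i; rewrite !mxE; have [->//|i0] := eqVneq i ord0.
  by have := xr i; rewrite ler_norml.
Qed.

(** The bound at infinity carries the factor [sin (pi t / c)], so the comparison
    function dominates on the lateral faces of every large box. *)
Lemma strip_liouville H (c a m : R) : 0 < c -> 0 < a -> 0 <= m ->
  n%:R = 2 * m + 1 -> pi / c * a = 2 * m + 2 ->
  (forall z, 0 <= z 0 ord0 <= c -> harm H z) ->
  (forall z, z 0 ord0 = 0 \/ z 0 ord0 = c -> H z = 0) ->
  (forall e : R, 0 < e -> exists L : R, forall z, 0 <= z 0 ord0 <= c ->
     L <= lateral_sq z -> `|H z| <= e * radial_barrier (pi / c) m a z) ->
  forall z, 0 <= z 0 ord0 <= c -> H z = 0.
Proof.
move=> c0 a0 m0 nm ka hH H0 gH z zc; apply/eqP; rewrite eq_le; apply/andP; split.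
  apply: (strip_liouville_half c0 a0 m0 nm ka) => // [u /H0->//|e /gH[L hL]].
  by exists L => u uc uL; apply: le_trans (ler_norm _) (hL u uc uL).
rewrite -oppr_le0.
apply: (@strip_liouville_half (fun z => - H z) c a m) => // [u /hH|u /H0->|e /gH[L hL]].
- exact: harmN.
- by rewrite oppr0.
- exists L => u uc uL; apply: le_trans (hL u uc uL).
  by rewrite -normrN ler_norm.
Qed.

(** A crude triangle inequality, from [|x_i| <= |x|] in each coordinate; the factor
    [n] instead of its square root is harmless. *)
Lemma lateral_norm_le x z (r : R) : 0 <= r ->
  (forall i, i != ord0 -> `|z 0 i - x 0 i| <= r) ->
  Num.sqrt (lateral_sq z) <= Num.sqrt (lateral_sq x) + r * n%:R.
Proof.
move=> r0 h; set q := Num.sqrt (lateral_sq x).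
have q0 : 0 <= q by exact: sqrtr_ge0.
have rn : 0 <= r * n%:R by rewrite mulr_ge0.
have xq i : i != ord0 -> `|x 0 i| <= q.
  move=> i0; rewrite /q -sqrtr_sqr ler_wsqrtr// /lateral_sq (bigD1 i)//=.
  by rewrite lerDl; apply: sumr_ge0 => j _; exact: sqr_ge0.
rewrite -(ger0_norm (addr_ge0 q0 rn)) -sqrtr_sqr ler_wsqrtr//.
apply: (@le_trans _ _ (\sum_(i < n.+1 | i != ord0) (x 0 i ^+ 2 + (2 * r * q + r ^+ 2)))).
  apply: ler_sum => i i0.
  have := h i i0; have := xq i i0; rewrite !ler_norml => /andP[a1 a2] /andP[b1 b2].
  set d := z 0 i - x 0 i in b1 b2.
  have -> : z 0 i = x 0 i + d by rewrite /d; ring.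
  have : x 0 i * d <= r * q.
    have [d0|d0] := leP 0 d; first by nra.
    by nra.
  have : d ^+ 2 <= r ^+ 2 by nra.
  by nra.
rewrite big_split /= sum_lateral_cst -/(lateral_sq x).
have -> : lateral_sq x = q ^+ 2 by rewrite /q sqr_sqrtr// lateral_sq_ge0.
have nn : n%:R <= n%:R ^+ 2 :> R by rewrite -natrX ler_nat; case: (n) => // k; rewrite expnS leq_pmulr// expn_gt0.
have := ler_wpM2l (sqr_ge0 r) nn.
rewrite sqrrD exprMn; nra.
Qed.

(** If [r] and [s] are the norms of two points at distance at most [D], the growth
    rates there differ by a bounded factor: the exponential by [exp (k D)], and the
    power by [2^m], because [sqrt (a^2 + s^2) <= a + s <= 2 r]. *)
Lemma growth_compare (k m a D r s : R) : 0 < k -> 0 <= m -> 0 < a -> 0 <= D ->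
  0 <= s -> r <= s + D -> s <= r + D -> a + D <= r ->
  expR (k * r - m * ln r) <= expR (k * D + m * ln 2) * radial k m (a ^+ 2 + s ^+ 2).
Proof.
move=> k0 m0 a0 D0 s0 rs sr ar.
have a2 : 0 < a ^+ 2 by rewrite exprn_gt0.
pose q := Num.sqrt (a ^+ 2 + s ^+ 2).
have q2 : q ^+ 2 = a ^+ 2 + s ^+ 2.
  by rewrite sqr_sqrtr// addr_ge0 ?sqr_ge0.
have q0 : 0 < q by rewrite sqrtr_gt0 ltr_pwDl// sqr_ge0.
have sq : s <= q by nra.
have qr : q <= 2 * r by nra.
have r0 : 0 < r by lra.
rewrite /radial -/q -expRD ler_expR -q2.
rewrite lnXn// -[ln q *+ 2]mulr_natr.
have lq : ln q <= ln 2 + ln r.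
  by rewrite -lnM ?posrE// ler_ln ?posrE// mulr_gt0.
have h1 : k * r <= k * (q + D) by apply: ler_wpM2l; lra.
have := ler_wpM2l m0 lq; lra.
Qed.

End Liouville.

(** * Reduction to real functions *)
Section SmoothFunctions.
Variables (R : realType) (n : nat) (V : normedModType R).
Implicit Types (f g : 'rV[R]_n -> V) (G : set 'rV[R]_n).

Lemma partial_eq_near i f g x : (\forall y \near x, f y = g y) ->
  partial i f x = partial i g x.
Proof. move=> E. exact (near_eq_derive _ E). Qed.

Lemma continuous_eq_near f g x : (\forall y \near x, f y = g y) ->
  {for x, continuous f} -> {for x, continuous g}.
Proof.
move=> E cf; rewrite /prop_for /continuous_at -(nbhs_singleton E).
have F : Filter (nbhs x) := nbhs_filter x.
apply: cvg_trans cf; apply: (@near_eq_cvg _ _ (nbhs x) F).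
by apply: filterS E => y ->.
Qed.

Lemma Cn_on_eq (k : nat) G f g : open G -> (forall x, G x -> f x = g x) ->
  Cn_on k G f -> Cn_on k G g.
Proof.
move=> oG; elim: k f g => [|k IH] f g E /= [cf hf];
    have nE x : G x -> \forall y \near x, f y = g y by
      move=> Gx; have F : Filter (nbhs x) := nbhs_filter x;
      apply: filterS (open_nbhs_nbhs (conj oG Gx)) => y /E.
  by split=> // x Gx; apply: continuous_eq_near (nE x Gx) (cf x Gx).
split=> [x Gx|i]; first exact: continuous_eq_near (nE x Gx) (cf x Gx).
have [df hi] := hf i; split=> [x Gx|].
  exact: (near_eq_derivable (nE x Gx) (df x Gx)).
by apply: IH hi => x Gx; apply: partial_eq_near; exact: nE.
Qed.

Lemma Cn_on_cst0 (k : nat) G : open G -> Cn_on k G (fun=> 0 : V).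
Proof.
move=> oG; elim: k => [|k IH] /=; split=> //; first by move=> x _; exact: cst_continuous.
  by move=> x _; exact: cst_continuous.
move=> i; split=> [x _|]; first exact: derivable_cst.
by apply: Cn_on_eq IH => // x _; rewrite /partial derive_cst.
Qed.

Lemma Cn_onD (k : nat) G f g : open G -> Cn_on k G f -> Cn_on k G g ->
  Cn_on k G (fun x => f x + g x).
Proof.
move=> oG; elim: k f g => [|k IH] f g /= [cf hf] [cg hg].
  by split=> // x Gx; exact: (cvgD (cf x Gx) (cg x Gx)).
split=> [x Gx|i]; first exact: (cvgD (cf x Gx) (cg x Gx)).
have [df hi] := hf i; have [dg hj] := hg i; split=> [x Gx|].
  by apply: derivableD; [exact: df|exact: dg].
apply: Cn_on_eq (IH _ _ hi hj) => // x Gx.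
by rewrite /partial deriveD//; [exact: df|exact: dg].
Qed.

Lemma Cn_on_sum (k : nat) G (I : Type) (r : seq I) (F : I -> 'rV[R]_n -> V) :
  open G -> (forall i, Cn_on k G (F i)) -> Cn_on k G (fun x => \sum_(i <- r) F i x).
Proof.
move=> oG hF; elim: r => [|i r IH].
  by apply: Cn_on_eq (Cn_on_cst0 k oG) => // x _; rewrite big_nil.
by apply: Cn_on_eq (Cn_onD oG (hF i) IH) => // x _; rewrite big_cons.
Qed.

Lemma Cn_on_laplacian (k : nat) G f : open G -> Cn_on k.+2 G f ->
  Cn_on k G (laplacian f).
Proof.
by move=> oG [_ hf]; apply: Cn_on_sum => // i; have [_ [_ /(_ i)[]]] := hf i.
Qed.

Lemma Cn_on_cont (k : nat) G f : Cn_on k G f -> forall x, G x -> {for x, continuous f}.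
Proof. by case: k => [|k] []. Qed.

End SmoothFunctions.

Section ScalarReduction.
Variables (R : realType) (n : nat) (V : normedModType R).
Implicit Types (f : 'rV[R]_n -> V) (G : set 'rV[R]_n).
(** [phi] is a contracting linear form; the real and imaginary parts are the
    instances of interest. *)
Variable phi : V -> R.
Hypotheses (phiD : forall y z, phi (y + z) = phi y + phi z)
  (phiZ : forall (k : R) z, phi (k *: z) = k * phi z)
  (phi_le : forall z, `|phi z| <= `|z|).

Lemma phi_sum (I : Type) (r : seq I) (F : I -> V) :
  phi (\sum_(i <- r) F i) = \sum_(i <- r) phi (F i).
Proof.
elim: r => [|i r IH]; last by rewrite !big_cons phiD IH.
by rewrite !big_nil -(scale0r 0) phiZ mul0r.
Qed.

Lemma phiB y z : phi (y - z) = phi y - phi z.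
Proof. by rewrite phiD -scaleN1r phiZ mulN1r. Qed.

Lemma phi_cvg (T : Type) (F : set_system T) (f : T -> V) (l : V) : Filter F ->
  f @ F --> l -> (fun x => phi (f x)) @ F --> phi l.
Proof.
move=> FF /cvgrPdist_le h; apply/cvgrPdist_le => e e0.
by apply: filterS (h e e0) => x; rewrite -phiB; apply: le_trans.
Qed.

Lemma is_derive_phi f (x : 'rV[R]_n) (i : 'I_n) : derivable f x (delta_mx 0 i) ->
  is_derive (0 : R) 1 (fun s => phi (f (line x i s))) (phi (partial i f x)).
Proof.
move=> df; apply/is_deriveP.
have /cvg_ex[l hl] := df.
have -> : partial i f x = l by rewrite /partial /derive; apply: cvg_lim hl.
have F : Filter ((0 : R)^') by exact: dnbhs_filter.
have := phi_cvg F hl.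
rewrite (_ : (fun h : R => phi _) =
    fun h => h^-1 * (phi (f (line x i (h + 0))) - phi (f (line x i 0))))//.
by apply/funext => h; rewrite /= addr0 phiZ phiB line0 /line (addrC x).
Qed.

Lemma cont_phi f (x : 'rV[R]_n) : {for x, continuous f} -> cont (fun z => phi (f z)) x.
Proof.
move=> cf; have F : Filter (nbhs x) := nbhs_filter x.
exact: (@phi_cvg _ (nbhs x) f (f x) F cf).
Qed.

Lemma lap_phi G f x : open G -> Cn_on 2 G f -> G x ->
  lap (fun z => phi (f z)) x (phi (laplacian f x)).
Proof.
move=> oG [_ hf] Gx; exists (fun i => phi (partial i (partial i f) x)).
split; last by rewrite /laplacian phi_sum.
move=> i; have [df [_ h2]] := hf i; have [d2 _] := h2 i.
exists (fun s => phi (partial i f (line x i s))); split; last exact: is_derive_phi (d2 x Gx).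
have c := @cvg_line R n x i 0; rewrite line0 in c.
have N : \forall s \near (0 : R), G (line x i s).
  exact: (c _ (open_nbhs_nbhs (conj oG Gx))).
apply: filterS N => s Gs; apply: (@is_derive_line _ _ (fun z => phi (f z))).
exact: is_derive_phi (df _ Gs).
Qed.

End ScalarReduction.

Lemma Re_le_norm (R : realType) (z : Rcomplex R) : `|complex.Re z| <= `|z|.
Proof.
case: z => x y /=; rewrite -sqrtr_sqr -[leRHS]/(Num.sqrt (x ^+ 2 + y ^+ 2)).
by rewrite ler_wsqrtr// lerDl sqr_ge0.
Qed.

Lemma Im_le_norm (R : realType) (z : Rcomplex R) : `|complex.Im z| <= `|z|.
Proof.
case: z => x y /=; rewrite -sqrtr_sqr -[leRHS]/(Num.sqrt (x ^+ 2 + y ^+ 2)).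
by rewrite ler_wsqrtr// lerDr sqr_ge0.
Qed.

(** * The even part vanishes *)
Section EvenPart.
Variables (R : realType) (d : nat) (V : normedModType R).

Lemma flip_put (a b : R) (z : 'rV[R]_d.+1) (t : R) :
  flip ord0 a b (put z t) = put z (a + b * t).
Proof. by rewrite /flip line_put put_diag; congr put; ring. Qed.

Lemma is_derive_flip (f : 'rV[R]_d.+1 -> R) (i : 'I_d.+1) (a b l : R)
    (z : 'rV[R]_d.+1) :
  is_derive (0 : R) 1 (fun s => f (line (flip ord0 a b z) i s)) l ->
  is_derive (0 : R) 1 (fun s => f (flip ord0 a b (line z i s)))
    ((if i == ord0 then b else 1) * l).
Proof.
move=> h.
set e := if _ then _ else _.
rewrite (_ : (fun s => _) = fun s => f (line (flip ord0 a b z) i (0 + e * s))).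
  apply: (@is_derive_chain R (fun s => f (line (flip ord0 a b z) i s))
    (fun s => 0 + e * s) 0 l e) => //; last exact: is_derive_affine.
  by rewrite mulr0 addr0.
apply/funext => s; rewrite flip_line add0r /e.
by case: ifP; rewrite ?mul1r.
Qed.

Definition slab (a b : R) : set 'rV[R]_d.+1 := [set x | a < x 0 ord0 < b].

Lemma open_slab (a b : R) : open (slab a b).
Proof.
have -> : slab a b = (fun x : 'rV[R]_d.+1 => x 0 ord0) @^-1` `]a, b[%classic.
  by apply/seteqP; split => x; rewrite /slab /= in_itv.
apply: open_comp; last exact: itv_open.
by move=> x _; exact: cont_coord.
Qed.

Implicit Types x y z : 'rV[R]_d.+1.

Variable phi : V -> R.
Hypotheses (phiD : forall p q : V, phi (p + q) = phi p + phi q)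
  (phiZ : forall (r : R) (p : V), phi (r *: p) = r * phi p)
  (phi_le : forall p : V, `|phi p| <= `|p|).
Variables (a b t1 c : R) (u : 'rV[R]_d.+1 -> V).
Hypotheses (hd : (1 <= d)%N) (c0 : 0 < c) (hac : a < t1 - c) (hcb : t1 + c < b)
  (hC : Cn_on 4 (slab a b) u)
  (hu : forall x, slab a b x -> laplacian (laplacian u) x = 0)
  (hu0 : forall z, z 0 ord0 = t1 -> u z = 0)
  (hu1 : forall z, u (put z (t1 + c)) = - u (put z (t1 - c))).

Let T := @flip R d.+1 ord0 t1 1.
Let S := @flip R d.+1 ord0 t1 (-1).
Let W := laplacian u.
(** Twice the even part of [phi \o u], and its Laplacian. *)
Let v z := phi (u (T z)) + phi (u (S z)).
Let w z := phi (W (T z)) + phi (W (S z)).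
Let b' := Num.min (t1 - a) (b - t1).

Let phi0 : phi 0 = 0.
Proof. by have := phiZ 0 0; rewrite scale0r mul0r. Qed.

Let cb' : c < b'.
Proof.
have := hac; have := hcb => h1 h2.
by rewrite lt_min; apply/andP; split; lra.
Qed.

Let inG z : - b' < z 0 ord0 < b' -> slab a b (T z) /\ slab a b (S z).
Proof.
rewrite /slab /= /T /S !flip_diag mul1r mulN1r => /andP[z1 z2].
have b1 : b' <= t1 - a by rewrite /b' ge_min lexx.
have b2 : b' <= b - t1 by rewrite /b' ge_min lexx orbT.
by split; apply/andP; split; lra.
Qed.

Let CW : Cn_on 2 (slab a b) W.
Proof. by apply: Cn_on_laplacian hC; exact: open_slab. Qed.

Let hv z : - b' < z 0 ord0 < b' -> cont v z /\ lap v z (w z).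
Proof.
move=> /inG[GT GS].
have C2 : Cn_on 2 (slab a b) u.
  have [cu hi] := hC; split => // i; have [di [ci hj]] := hi i; split=> //.
  split=> // j; have [dj [cj _]] := hj j; split=> //; split=> //.
have cu x : slab a b x -> cont (fun z => phi (u z)) x.
  by move=> Gx; apply: cont_phi => //; exact: Cn_on_cont hC _ Gx.
have lu x : slab a b x -> lap (fun z => phi (u z)) x (phi (W x)).
  by move=> Gx; exact: (lap_phi phiD phiZ phi_le (@open_slab a b) C2 Gx).
split.
  by apply: contD; apply: (@cont_flip _ _ _ _ _ (fun z => phi (u z))); exact: cu.
by apply: lapD; apply: (@lap_flip _ _ _ _ _ (fun z => phi (u z)));
  rewrite ?sqrrN ?expr1n//; exact: lu.
Qed.

Let hw : C2_harmonic b' w.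
Proof.
have [cW hW] := CW.
pose sg (i : 'I_d.+1) : R := if i == ord0 then -1 else 1.
exists (fun i z => phi (partial i W (T z)) + sg i * phi (partial i W (S z))).
exists (fun i z => phi (partial i (partial i W) (T z)) +
                   phi (partial i (partial i W) (S z))).
have CP f z : - b' < z 0 ord0 < b' -> (forall x, slab a b x -> {for x, continuous f}) ->
    cont (fun z => phi (f (T z))) z /\ cont (fun z => phi (f (S z))) z.
  move=> /inG[GT GS] cf.
  by split; apply: (@cont_flip _ _ _ _ _ (fun z => phi (f z)));
    apply: cont_phi => //; exact: cf.
split.
- by move=> z zb; have [h1 h2] := CP W z zb cW; exact: contD.
- move=> i z zb; have [di [ci _]] := hW i.
  have [h1 h2] := CP _ z zb ci.
  by apply: contD => //; apply: contM => //; exact: cont_cst.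
- move=> i z zb; have [_ [_ hi]] := hW i; have [_ ci] := hi i.
  by have [h1 h2] := CP _ z zb ci.1; exact: contD.
move=> z zb; have [GT GS] := inG zb; split.
- move=> i; have [di _] := hW i; apply: is_deriveD.
    have := @is_derive_flip (fun z => phi (W z)) i t1 1 _ z
      (is_derive_phi phiD phiZ phi_le (di _ GT)).
    by rewrite if_same mul1r.
  exact: (@is_derive_flip (fun z => phi (W z)) i t1 (-1) _ z
      (is_derive_phi phiD phiZ phi_le (di _ GS))).
- move=> i; have [_ [_ hi]] := hW i; have [di _] := hi i; apply: is_deriveD.
    have := @is_derive_flip (fun z => phi (partial i W z)) i t1 1 _ z
      (is_derive_phi phiD phiZ phi_le (di _ GT)).
    by rewrite if_same mul1r.
  have := is_deriveZ (sg i) (@is_derive_flip (fun z => phi (partial i W z)) i t1 (-1) _ z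
      (is_derive_phi phiD phiZ phi_le (di _ GS))).
  rewrite -/(sg i) /GRing.scale /= mulrA (_ : sg i * sg i = 1) ?mul1r//.
  by rewrite /sg; case: ifP; rewrite ?mulrNN mulr1.
- have E x : slab a b x -> \sum_i phi (partial i (partial i W) x) = 0.
    move=> Gx; have h := phi_sum phiD phiZ (index_enum 'I_d.+1)
      (fun i => partial i (partial i W) x).
    exact: etrans (esym h) (etrans (congr1 phi (hu Gx)) phi0).
  have h := etrans (congr2 +%R (E _ GT) (E _ GS)) (addr0 0).
  exact: etrans (big_split _ _ _ _ _) h.
Qed.

Let m : R := (d%:R - 1) / 2.
Let k : R := pi / c.

Hypothesis growth : forall e : R, 0 < e -> exists M : R, forall z,
  t1 - c <= z 0 ord0 <= t1 + c -> M < Num.sqrt (lateral_sq z) ->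
  `|u z| <= e * expR (k * Num.sqrt (lateral_sq z) - m * ln (Num.sqrt (lateral_sq z))).

Let H := half_primitive ((c + b') / 2) w.

Let bt0 : 0 < (c + b') / 2 /\ c < (c + b') / 2 < b'.
Proof. by have := c0; have := cb'; move=> h1 h2; split; [|apply/andP; split]; lra. Qed.

Let we z t : w (put z (- t)) = w (put z t).
Proof. rewrite /w /T /S !flip_put !mul1r !mulN1r opprK; exact: addrC. Qed.

Let ve z t : v (put z (- t)) = v (put z t).
Proof. rewrite /v /T /S !flip_put !mul1r !mulN1r opprK; exact: addrC. Qed.

Let v0 z : z 0 ord0 = 0 -> v z = 0.
Proof.
move=> z0.
have h e : u (flip ord0 t1 e z) = 0.
  by apply: hu0; rewrite flip_diag z0 mulr0 addr0.
by rewrite /v /T /S !h phi0 addr0.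
Qed.

Let vH z : 0 <= z 0 ord0 <= c -> v z = z 0 ord0 * H z.
Proof.
move=> /andP[z0 zc]; have [h0 /andP[h1 h2]] := bt0.
apply: (almansi h0 h2 hw we ve hv v0); apply/andP; split=> //; lra.
Qed.

Let hH z : 0 <= z 0 ord0 <= c -> harm H z.
Proof.
move=> /andP[z0 zc]; have [h0 /andP[h1 h2]] := bt0.
by apply: (harm_half_primitive h0 h2 hw we); apply/andP; split; lra.
Qed.

Let H0 z : z 0 ord0 = 0 \/ z 0 ord0 = c -> H z = 0.
Proof.
case=> zc; first exact: half_primitive0.
have cc : 0 <= z 0 ord0 <= c by rewrite zc lexx (ltW c0).
have : v z = 0.
  rewrite /v -(put_id z) zc /T /S !flip_put mul1r mulN1r hu1.
  by rewrite -scaleN1r phiZ mulN1r addNr.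
rewrite vH// zc => /eqP; rewrite mulf_eq0 gt_eqF//= => /eqP->//.
Qed.

Let v_le z (B : R) : 0 <= z 0 ord0 <= c ->
  (forall y, t1 - c <= y 0 ord0 <= t1 + c -> lateral_sq y = lateral_sq z ->
    `|u y| <= B) -> `|v z| <= 2 * B.
Proof.
move=> /andP[z0 zc] hB.
have lat e : lateral_sq (flip ord0 t1 e z) = lateral_sq z by exact: lateral_sq_line0.
apply: le_trans (ler_normD _ _) _; rewrite mulr_natl mulr2n; apply: lerD.
  apply: le_trans (phi_le _) (hB _ _ (lat _)).
  by rewrite flip_diag; apply/andP; split; lra.
apply: le_trans (phi_le _) (hB _ _ (lat _)).
by rewrite flip_diag; apply/andP; split; lra.
Qed.

Lemma even_part_zero z t : - c <= t <= c ->
  phi (u (put z (t1 + t))) + phi (u (put z (t1 - t))) = 0.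
Proof.
have C0 := c0; have P0 : 0 < pi :> R := pi_gt0 R.
have k0 : 0 < k by rewrite divr_gt0.
have m0 : 0 <= m by rewrite divr_ge0// subr_ge0 ler1n.
have nm : d%:R = 2 * m + 1 by rewrite /m; field.
pose al := (2 * m + 2) / k.
have al0 : 0 < al by rewrite divr_gt0//; lra.
have ka : k * al = 2 * m + 2 by rewrite /al; field; rewrite gt_eqF.
have ec0 : 0 < edge_constant d c.
  rewrite /edge_constant; have d0 : 0 < d%:R :> R by rewrite ltr0n.
  by rewrite !mulr_gt0// addr_gt0// ?invr_gt0// mulr_gt0.
have cos10 : 0 < cos 1 :> R := cos1_gt0 R.
have gH (e : R) : 0 < e -> exists L : R, forall x, 0 <= x 0 ord0 <= c ->
    L <= lateral_sq x -> `|H x| <= e * radial_barrier k m al x.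
  move=> e0; pose D : R := 2 * d%:R.
  have D0 : 0 <= D by rewrite mulr_ge0.
  pose C1 := expR (k * D + m * ln 2).
  have C10 : 0 < C1 by exact: expR_gt0.
  (* Chosen so that the constants of the local bound, of the sine and of the change
     of base point combine to [e]. *)
  pose eta := e * (cos 1 / 2 * k) / (edge_constant d c * 2 * C1).
  have eta0 : 0 < eta.
    have h1 : 0 < cos 1 / 2 * k by apply: mulr_gt0 => //; apply: divr_gt0.
    have h2 : 0 < edge_constant d c * 2 * C1 by apply: mulr_gt0 => //; apply: mulr_gt0.
    exact: divr_gt0 (mulr_gt0 e0 h1) h2.
  have [M hM] := growth eta0.
  pose R0 := `|M| + 1 + al + 2 * D.
  have R00 : 0 <= R0 by rewrite /R0; have := normr_ge0 M; lra.
  exists (R0 ^+ 2) => x xc Lx.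
  pose s := Num.sqrt (lateral_sq x).
  have sR : R0 <= s by rewrite /s -(ger0_norm R00) -sqrtr_sqr ler_wsqrtr.
  have ss : s ^+ 2 = lateral_sq x by rewrite sqr_sqrtr// lateral_sq_ge0.
  pose x0 := put x 0.
  have xx : x = line x0 ord0 (x 0 ord0) by rewrite line_put add0r put_id.
  have lat0 : lateral_sq x0 = lateral_sq x by exact: lateral_sq_line0.
  pose Ph := radial k m (al ^+ 2 + lateral_sq x).
  have Ph0 : 0 < Ph by exact: radial_gt0.
  pose B := 2 * (eta * (C1 * Ph)).
  have B0 : 0 < B.
    by apply: mulr_gt0 => //; apply: mulr_gt0 => //; exact: mulr_gt0.
  have QB : forall y, 0 <= y 0 ord0 <= c ->
      (forall i, i != ord0 -> `|y 0 i - x0 0 i| <= 2) ->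
      [/\ harm H y, `|y 0 ord0 * H y| <= B & y 0 ord0 = 0 \/ y 0 ord0 = c -> H y = 0].
    move=> y yc yx; split; [exact: hH| |exact: H0].
    rewrite -vH//; apply: v_le => // y' y'c laty.
    pose r := Num.sqrt (lateral_sq y).
    have rs : r <= s + D.
      by rewrite /s -lat0; apply: lateral_norm_le.
    have sr : s <= r + D.
      rewrite /s -lat0; apply: lateral_norm_le => // i i0.
      by rewrite distrC; exact: yx.
    have rR : al + D <= r /\ M < r.
      by move: sR; rewrite /R0; have := ler_norm M; have := normr_ge0 M; split; lra.
    have := hM y' y'c; rewrite laty -/r => /(_ rR.2) /le_trans; apply.
    rewrite ler_pM2l//; rewrite /Ph -ss.
    exact: (growth_compare k0 m0 al0 D0 (sqrtr_ge0 _) rs sr rR.1).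
  have := quotient_edge_bound C0 B0 (put_diag _ _) QB xc; rewrite -xx => /le_trans; apply.
  have := min_le_sin C0 xc; rewrite -/k => hs.
  have Eq : edge_constant d c * B = e * (cos 1 / 2 * k) * Ph.
    by rewrite /B /eta; field; rewrite !gt_eqF.
  rewrite Eq /radial_barrier -/Ph.
  have := ler_wpM2l (ltW (mulr_gt0 e0 Ph0)) hs; lra.
have Hz x : 0 <= x 0 ord0 <= c -> H x = 0.
  exact: (strip_liouville C0 al0 m0 nm ka hH H0 gH).
have pos s : 0 <= s <= c -> phi (u (put z (t1 + s))) + phi (u (put z (t1 - s))) = 0.
  move=> sc; have sc' : 0 <= put z s 0 ord0 <= c by rewrite put_diag.
  have := vH sc'; rewrite Hz// mulr0 /v /T /S !flip_put.
  by rewrite mul1r mulN1r.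
move=> /andP[t1' t2']; have [t0|t0] := leP 0 t; first by apply: pos; rewrite t0.
by rewrite addrC; have := pos (- t); rewrite opprK; apply; apply/andP; split; lra.
Qed.

End EvenPart.

(** * Coordinates on the strip *)
Section StripCoordinates.
Variables (R : realType) (d : nat).
Implicit Types (z : 'rV[R]_d.+1) (y : 'rV[R]_d).

Definition lateral z : 'rV[R]_d := \row_j z 0 (lift ord0 j).

Lemma pt_ord0 (t : R) y : (pt t y : 'rV[R]_d.+1) 0 ord0 = t.
Proof.
have e : ord0 = lshift d ord0 :> 'I_(1 + d) by exact: val_inj.
have E : pt t y 0 (lshift d ord0) = t by rewrite /pt row_mxEl mxE eqxx mulr1n.
exact: etrans (congr1 (fun i => pt t y 0 i) e) E.
Qed.

Lemma pt_lift (t : R) y j : (pt t y : 'rV[R]_d.+1) 0 (lift ord0 j) = y 0 j.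
Proof.
have e : lift ord0 j = rshift 1 j :> 'I_(1 + d) by exact: val_inj.
have E : pt t y 0 (rshift 1 j) = y 0 j by rewrite /pt row_mxEr.
exact: etrans (congr1 (fun i => pt t y 0 i) e) E.
Qed.

Lemma pt_lateral z : pt (z 0 ord0) (lateral z) = z.
Proof.
apply/rowP => i; case: (unliftP ord0 i) => [j ->|->]; last exact: pt_ord0.
by rewrite pt_lift mxE.
Qed.

Lemma put_pt (t s : R) y : put (pt t y : 'rV[R]_d.+1) s = pt s y.
Proof.
apply/rowP => i; case: (unliftP ord0 i) => [j ->|->].
  by rewrite put_off// !pt_lift.
by rewrite put_diag pt_ord0.
Qed.

Lemma enorm_lateral z : enorm (lateral z) = Num.sqrt (lateral_sq z).
Proof.
congr Num.sqrt; rewrite /lateral_sq [RHS]big_mkcond [RHS]big_ord_recl /= add0r.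
by apply: eq_bigr => j _; rewrite mxE.
Qed.

Lemma strip_slab (a b : R) : (strip d a b : set 'rV[R]_d.+1) = slab a b.
Proof.
apply/seteqP; split => [x [t + [y _ <-]]|x ab].
  by rewrite /slab /= in_itv /= => h; rewrite pt_ord0.
exists (x 0 ord0); first by rewrite /= in_itv.
by exists (lateral x) => //; exact: pt_lateral.
Qed.

End StripCoordinates.

Lemma powR_expR_growth (R : realType) (d : nat) (k r : R) : 0 < r ->
  r `^ ((1 - d%:R) / 2) * expR (k * r) = expR (k * r - (d%:R - 1) / 2 * ln r).
Proof.
move=> r0; rewrite /powR gt_eqF// -expRD; congr expR; lra.
Qed.

Theorem theorem7 (R : realType) (d : nat) (hd : (1 <= d)%N) (a b : R)
  (u : 'rV[R]_(1 + d) -> Rcomplex R)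
  (hu : biharmonic (strip d a b) u)
  (t1 c : R) (ht1 : a < t1 < b) (hc : 0 < c)
  (hac : a < t1 - c) (hcb : t1 + c < b)
  (hu0 : forall y : 'rV[R]_d, u (pt t1 y) = 0)
  (hu1 : forall y : 'rV[R]_d, u (pt (t1 + c) y) = - u (pt (t1 - c) y))
  (hgrowth :
     (fun y : 'rV[R]_d =>
        sup [set `|u (pt t y)| | t in `[t1 - c, t1 + c]] /
        ((enorm y `^ ((1 - d%:R) / 2)) * expR (pi / c * enorm y)))
     @ enorm_infty --> (0 : R)) :
  forall (t : R) (y : 'rV[R]_d), - c <= t <= c ->
    u (pt (t1 + t) y) = - u (pt (t1 - t) y).
Proof.
have [hC hl] := hu; rewrite strip_slab in hC hl.
have cu := Cn_on_cont hC.
have sup_ub (t : R) y : t1 - c <= t <= t1 + c ->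
    `|u (pt t y)| <= sup [set `|u (pt s y)| | s in `[t1 - c, t1 + c]].
  move=> tc; apply: ub_le_sup; last by exists t => //=; rewrite in_itv.
  have cF : {within `[t1 - c, t1 + c], continuous (fun s => `|u (pt s y)|)}.
    apply: continuous_in_subspaceT => s; rewrite inE /= in_itv /= => /andP[s1 s2].
    have E : (fun s => `|u (pt s y)|) = (fun s => `|u (put (pt 0 y) s)|).
      by apply/funext => r; rewrite put_pt.
    rewrite E.
    have cs : put (pt 0 y : 'rV[R]_d.+1) r @[r --> s] --> put (pt 0 y : 'rV[R]_d.+1) s.
      have c1 : (r - (pt 0 y : 'rV[R]_d.+1) 0 ord0) @[r --> s] -->
          s - (pt 0 y : 'rV[R]_d.+1) 0 ord0 by exact: (cvgB cvg_id (cvg_cst _)).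
      exact: (cvgD (cvg_cst _) (cvgZr_tmp c1)).
    have cus : {for put (pt 0 y : 'rV[R]_d.+1) s, continuous u}.
      by apply: cu; rewrite /slab /= put_diag; apply/andP; split; lra.
    apply: (@continuous_comp _ _ _ (fun r => u (put (pt 0 y) r)) Num.norm); last first.
      exact: norm_continuous.
    exact: (@continuous_comp _ _ _ (fun r => put (pt 0 y) r) u _ cs cus).
  have tt : t1 - c <= t1 + c by lra.
  have [m _ mF] := EVT_max tt cF.
  by exists `|u (pt m y)| => _ [s /= hs <-]; exact: mF.
have growth (e : R) : 0 < e -> exists M : R, forall z : 'rV[R]_d.+1,
    t1 - c <= z 0 ord0 <= t1 + c -> M < Num.sqrt (lateral_sq z) ->
    `|u z| <= e * expR (pi / c * Num.sqrt (lateral_sq z) -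
       (d%:R - 1) / 2 * ln (Num.sqrt (lateral_sq z))).
  move=> e0; have [M _ hM] := hgrowth _ (nbhsx_ballx (0 : R) e e0).
  exists (Num.max M 0) => z zc; rewrite gt_max -enorm_lateral => /andP[Mz z0].
  have := hM (lateral z) Mz; rewrite /= /ball /= sub0r normrN.
  rewrite powR_expR_growth// => /ltW; rewrite normrM normfV.
  rewrite (ger0_norm (expR_ge0 _)) ler_pdivrMr ?expR_gt0//.
  apply: le_trans; apply: le_trans (ler_norm _).
  by rewrite -{1}(pt_lateral z); exact: sup_ub.
have hu0' (z : 'rV[R]_d.+1) : z 0 ord0 = t1 -> u z = 0.
  by move=> zt; rewrite -(pt_lateral z) zt.
have hu1' (z : 'rV[R]_d.+1) : u (put z (t1 + c)) = - u (put z (t1 - c)).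
  by rewrite -(pt_lateral z) !put_pt.
have scal (phi : Rcomplex R -> R) (phiD : forall p q, phi (p + q) = phi p + phi q)
    (phiZ : forall (r : R) p, phi (r *: p) = r * phi p)
    (phi_le : forall p, `|phi p| <= `|p|) (t : R) y : - c <= t <= c ->
    phi (u (pt (t1 + t) y)) + phi (u (pt (t1 - t) y)) = 0.
  move=> tc.
  have := even_part_zero phiD phiZ phi_le hd hc hac hcb hC hl hu0' hu1' growth (pt 0 y) tc.
  by rewrite !put_pt.
move=> t y tc.
have hRe : complex.Re (u (pt (t1 + t) y)) + complex.Re (u (pt (t1 - t) y)) = 0.
  by apply: (scal (@complex.Re R)) tc => [[? ?] [? ?]|? [? ?]|p] //; exact: Re_le_norm.
have hIm : complex.Im (u (pt (t1 + t) y)) + complex.Im (u (pt (t1 - t) y)) = 0.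
  by apply: (scal (@complex.Im R)) tc => [[? ?] [? ?]|? [? ?]|p] //; exact: Im_le_norm.
move: hRe hIm; case: (u _) => x1 x2; case: (u _) => y1 y2 /= hRe hIm.
by congr (Complex _ _); lra.
Qed.
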